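(* The separation problem of the lifted extended polymatroid inequalities (or, of $\operatorname{conv}(X_0)$) can be solved in $O(n\log n)$ time. That is, there is an algorithm running in $O(n\log n)$ time which, given a point $(w^*,x^* )\in\mathbb{R}\times[0,1]^n$ with $\sum_{i\in N_k}x^*_i\le1$ for all $k\in[t]$, either finds an inequality $w\ge\sum_{i=1}^n\eta^\delta_{\delta_i}x_{\delta_i}$ (for some permutation $\delta$ of $[n]$) that is violated by $(w^*,x^* )$, or determines that none exists, in which case $(w^*,x^* )\in\operatorname{conv}(X_0)$.
   Context: For a non-negative integer $m$, $[m]=\{1,\dots,m\}$ with $[0]=\varnothing$. Let $n,t$ be positive integers, $f:\mathbb{R}\to\mathbb{R}$ a concave function with $f(0)=0$, $a\in\mathbb{R}^n$ with non-negative entries, and $\{N_k\}_{k\in[t]}$ a partition of $[n]$ into consecutive blocks: with $i_0:=0$ and $i_k:=\sum_{j=1}^k|N_j|$, $N_k=\{i_{k-1}+1,\dots,i_k\}$. Within each block the entries of $a$ are ascending: $a_{i_{k-1}+1}\le\cdots\le a_{i_k}$ for all $k\in[t]$. For $S\subseteq[n]$, $a(S):=\sum_{i\in S}a_i$. Define $$X_0=\Big\{(w,x)\in\mathbb{R}\times\{0,1\}^n:\ w\ge f(a^\top x),\ \sum_{i\in N_k}x_i\le1\ \forall k\in[t]\Big\}.$$ For a permutation $\delta=(\delta_1,\dots,\delta_n)$ of $[n]$, let $\delta(j):=\{\delta_1,\dots,\delta_j\}$. The lifting coefficients are defined recursively for $j=1,\dots,n$ by $$\eta^{\delta}_{\delta_j}:=\min_{S}\Big\{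 f(a(S))-\sum_{i\in S\setminus\{\delta_j\}}\eta^{\delta}_i \;:\; S\subseteq\delta(j),\ |S\cap N_k|\le 1\ \ \forall k\in[t],\ \delta_j\in S\Big\}.$$ The lifted extended polymatroid inequality defined by $\delta$ is $w\ge\sum_{i=1}^n\eta^\delta_{\delta_i}x_{\delta_i}$. The separation problem of $\operatorname{conv}(X_0)$ is: given $(w^*,x^* )$, either find a valid inequality for $\operatorname{conv}(X_0)$ violated by $(w^*,x^* )$ or prove that none exists, i.e. $(w^*,x^* )\in\operatorname{conv}(X_0)$; since the inequalities $0\le x_i\le1$ and $\sum_{i\in N_k}x_i\le1$ can be checked in linear time, the input point is assumed to satisfy them. Time is counted as the number of elementary operations (real arithmetic, comparisons, and evaluations of $f$ at a point, each at unit cost). *)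

(* Defs.v *)
From HB Require Import structures.
From mathcomp Require Import all_boot all_order all_fingroup all_algebra.
From mathcomp Require Import all_classical all_reals all_analysis.
Set Implicit Arguments.
Unset Strict Implicit.
Unset Printing Implicit Defensive.
Import Order.TTheory GRing.Theory Num.Theory.
Import numFieldNormedType.Exports.
Local Open Scope classical_set_scope.
Local Open Scope ring_scope.
Local Open Scope convex_scope.

(* Indices are 0-based throughout: [n] is 'I_n, and the permutation
   (delta_1, ..., delta_n) is delta : 'S_n with delta_(j+1) = delta j. *)

Definition concave (R : realType) (f : R -> R) : Prop :=
  forall (p : {i01 R}) (x y : R^o),
    (f x : R^o) <| p |> (f y : R^o) <= f (x <| p |> y).

Definition conv_hull (R : realType) (M : lmodType R) (A : set M) : set M :=
  smallest (@convex_set R M) A.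

Section Blocks.
Variables (n t : nat) (sz : 'I_t -> nat).

(* i_k = |N_1| + ... + |N_k|, with sz j = |N_(j+1)|. *)
Definition block_end (k : nat) : nat := (\sum_(j < t | (j < k)%N) sz j)%N.

Definition block (k : 'I_t) : {set 'I_n} :=
  [set i : 'I_n | (block_end k <= i < block_end k.+1)%N].

Definition consecutive_blocks : Prop :=
  (forall k, (0 < sz k)%N) /\ (\sum_k sz k = n)%N.

Definition gub_set (S : {set 'I_n}) : bool :=
  [forall k, (#|S :&: block k| <= 1)%N].

Definition prefix_set (delta : 'S_n) (j : 'I_n) : {set 'I_n} :=
  [set delta i | i : 'I_n & (i <= j)%N].

End Blocks.

Section MixedIntegerSet.
Variables (R : realType) (n t : nat) (sz : 'I_t -> nat).
Variables (f : R -> R) (a : 'rV[R]_n).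

Definition ascending_blocks : Prop :=
  forall (k : 'I_t) (i j : 'I_n), i \in block n sz k -> j \in block n sz k ->
    (i <= j)%N -> a 0 i <= a 0 j.

Definition gub_ineqs (x : 'rV[R]_n) : Prop :=
  forall k, \sum_(i in block n sz k) x 0 i <= 1.

Definition X0 : set (R^o * 'rV[R]_n) :=
  [set wx : R^o * 'rV[R]_n | [/\ f (\sum_i a 0 i * wx.2 0 i) <= wx.1,
                forall i, wx.2 0 i = 0 \/ wx.2 0 i = 1
              & gub_ineqs wx.2]].

Definition weight (S : {set 'I_n}) : R := \sum_(i in S) a 0 i.

Definition lift_candidate (delta : 'S_n) (j : 'I_n) (S : {set 'I_n}) : bool :=
  [&& S \subset prefix_set delta j, gub_set sz S & delta j \in S].

(* The default value f (a 0 (delta j)) of the iterated minimum is the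
   objective value of the candidate S = {delta_j}, so it does not alter
   the minimum. *)
Definition lift_min (delta : 'S_n) (eta : 'I_n -> R) (j : 'I_n) : R :=
  \big[Num.min/f (a 0 (delta j))]_(S : {set 'I_n} | lift_candidate delta j S)
    (f (weight S) - \sum_(i in S :\ delta j) eta i).

(* The coefficients of delta_1, ..., delta_m; the others are 0. *)
Fixpoint lift_upto (delta : 'S_n) (m : nat) : 'I_n -> R :=
  if m is m'.+1 then
    let eta := lift_upto delta m' in
    fun i => let j := ((delta^-1)%g : 'S_n) i in
      if j == m' :> nat then lift_min delta eta j else eta i
  else fun=> 0.

Definition lift_coef (delta : 'S_n) : 'I_n -> R := lift_upto delta n.

Definition lepi_rhs (delta : 'S_n) (x : 'rV[R]_n) : R :=
  \sum_i lift_coef delta (delta i) * x 0 (delta i).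

Lemma lift_uptoS delta m i :
  lift_upto delta m.+1 i =
  if ((delta^-1)%g : 'S_n) i == m :> nat
  then lift_min delta (lift_upto delta m) (((delta^-1)%g : 'S_n) i)
  else lift_upto delta m i.
Proof. by []. Qed.

Lemma lift_upto_stable delta m i :
  (((delta^-1)%g : 'S_n) i < m)%N -> (m <= n)%N ->
  lift_coef delta i = lift_upto delta m i.
Proof.
move=> im mn; rewrite /lift_coef -(subnKC mn).
elim: (n - m)%N => [|d IH]; first by rewrite addn0.
rewrite addnS lift_uptoS -IH ifF //; apply/negbTE.
by rewrite neq_ltn (leq_trans im) ?leq_addr.
Qed.

Lemma lift_coefE delta j :
  lift_coef delta (delta j) = lift_min delta (lift_coef delta) j.
Proof.
rewrite (@lift_upto_stable _ j.+1) ?permK // lift_uptoS permK eqxx.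
rewrite /lift_min; apply: eq_bigr => S /and3P[Sj _ _]; congr (_ - _).
apply: eq_bigr => i; rewrite !inE => /andP[ij iS].
move/fintype.subsetP: Sj => /(_ i iS) /imsetP[l]; rewrite inE => lj il.
apply/esym/lift_upto_stable; last exact: ltnW.
rewrite il permK ltn_neqAle lj andbT.
by apply: contra ij => /eqP/val_inj <-; rewrite il.
Qed.

End MixedIntegerSet.

(* A uniform real RAM as a while-language. The memory consists of
   arrays of natural numbers (used for indices and counters) and of
   arrays of real numbers, both addressed as cell (array, index); scalar
   variables are cells of index 0. Real data influence the control flow only
   through comparisons; f is available only as an oracle. *)

Inductive iexp :=
| IConst of nat
| IGet of nat & iexp
| IAdd of iexp & iexp
| ISub of iexp & iexp.

Inductive rexp :=
| RZero
| ROne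
| RGet of nat & iexp
| RAdd of rexp & rexp
| RSub of rexp & rexp
| RMul of rexp & rexp
| RDiv of rexp & rexp
| RCall of rexp.

Inductive bexp :=
| BILe of iexp & iexp
| BRLe of rexp & rexp
| BNot of bexp
| BAnd of bexp & bexp.

Inductive cmd :=
| Skip
| ISet of nat & iexp & iexp
| RSet of nat & iexp & rexp
| Seq of cmd & cmd
| If of bexp & cmd & cmd
| While of bexp & cmd.

(* Every node of an expression is charged one operation, memory accesses and
   index arithmetic included. *)
Fixpoint icost (e : iexp) : nat :=
  match e with
  | IConst _ => 1
  | IGet _ e1 => (icost e1).+1
  | IAdd e1 e2 | ISub e1 e2 => (icost e1 + icost e2).+1
  end.

Fixpoint rcost (e : rexp) : nat :=
  match e with
  | RZero | ROne => 1
  | RGet _ e1 => (icost e1).+1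
  | RAdd e1 e2 | RSub e1 e2 | RMul e1 e2 | RDiv e1 e2 =>
      (rcost e1 + rcost e2).+1
  | RCall e1 => (rcost e1).+1
  end.

Fixpoint bcost (e : bexp) : nat :=
  match e with
  | BILe e1 e2 => (icost e1 + icost e2).+1
  | BRLe e1 e2 => (rcost e1 + rcost e2).+1
  | BNot e1 => (bcost e1).+1
  | BAnd e1 e2 => (bcost e1 + bcost e2).+1
  end.

Section Semantics.
Variables (R : realType) (f : R -> R).

Record state := State {
  imem : nat -> nat -> nat;
  rmem : nat -> nat -> R
}.

Definition upd (T : Type) (mem : nat -> nat -> T) (x i : nat) (v : T) :=
  fun y j => if (y == x) && (j == i) then v else mem y j.

(* ISub is truncated subtraction. *)
Fixpoint ieval (s : state) (e : iexp) : nat :=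
  match e with
  | IConst c => c
  | IGet x e1 => imem s x (ieval s e1)
  | IAdd e1 e2 => (ieval s e1 + ieval s e2)%N
  | ISub e1 e2 => (ieval s e1 - ieval s e2)%N
  end.

Fixpoint reval (s : state) (e : rexp) : R :=
  match e with
  | RZero => 0
  | ROne => 1
  | RGet x e1 => rmem s x (ieval s e1)
  | RAdd e1 e2 => reval s e1 + reval s e2
  | RSub e1 e2 => reval s e1 - reval s e2
  | RMul e1 e2 => reval s e1 * reval s e2
  | RDiv e1 e2 => reval s e1 / reval s e2
  | RCall e1 => f (reval s e1)
  end.

Fixpoint beval (s : state) (e : bexp) : bool :=
  match e with
  | BILe e1 e2 => (ieval s e1 <= ieval s e2)%N
  | BRLe e1 e2 => reval s e1 <= reval s e2
  | BNot e1 => ~~ beval s e1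
  | BAnd e1 e2 => beval s e1 && beval s e2
  end.

(* exec P s c s': started in s, P terminates in s' after c operations. *)
Inductive exec : cmd -> state -> nat -> state -> Prop :=
| exec_skip s : exec Skip s 1 s
| exec_iset s x i e :
    exec (ISet x i e) s (icost i + icost e).+1
      (State (upd (imem s) x (ieval s i) (ieval s e)) (rmem s))
| exec_rset s x i e :
    exec (RSet x i e) s (icost i + rcost e).+1
      (State (imem s) (upd (rmem s) x (ieval s i) (reval s e)))
| exec_seq P Q s s1 s2 c1 c2 :
    exec P s c1 s1 -> exec Q s1 c2 s2 -> exec (Seq P Q) s (c1 + c2)%N s2
| exec_if b P Q s s1 c :
    exec (if beval s b then P else Q) s c s1 ->
    exec (If b P Q) s (bcost b + c).+1 s1
| exec_while_stop b P s :
    ~~ beval s b -> exec (While b P) s (bcost b).+1 s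
| exec_while_step b P s s1 s2 c1 c2 :
    beval s b -> exec P s c1 s1 -> exec (While b P) s1 c2 s2 ->
    exec (While b P) s (bcost b + c1 + c2).+1 s2.

Lemma exec_det P s c1 c2 s1 s2 :
  exec P s c1 s1 -> exec P s c2 s2 -> c1 = c2 /\ s1 = s2.
Proof.
move=> e1; elim: e1 c2 s2 => {P s c1 s1}.
- by move=> s c2 s2 e; inversion e.
- by move=> s x i e c2 s2 H; inversion H.
- by move=> s x i e c2 s2 H; inversion H.
- move=> P Q s s1 s2 c1 c2 _ IH1 _ IH2 c s' H.
  inversion H as [| | |? ? ? ? ? ? ? h1 h2| | |]; subst.
  by have [? ?] := IH1 _ _ h1; subst; have [-> ->] := IH2 _ _ h2.
- move=> b P Q s s1 c _ IH c2 s2 H.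
  inversion H as [| | | |? ? ? ? ? ? h| |]; subst.
  by have [-> ->] := IH _ _ h.
- move=> b P s nb c s' H.
  inversion H as [| | | | | |? ? ? ? ? ? ? bs]; subst => //.
  by rewrite bs in nb.
- move=> b P s s1 s2 c1 c2 bs _ IH1 _ IH2 c s' H.
  inversion H as [| | | | |? ? ? nb|? ? ? ? ? ? ? _ h1 h2]; subst.
    by rewrite bs in nb.
  by have [? ?] := IH1 _ _ h1; subst; have [-> ->] := IH2 _ _ h2.
Qed.

End Semantics.

Section InputOutput.
Variables (R : realType) (n t : nat) (sz : 'I_t -> nat).
Variables (f : R -> R) (a : 'rV[R]_n) (w : R) (x : 'rV[R]_n).

Definition cells (T : Type) (d : T) (m : nat) (u : 'I_m -> T) : nat -> T :=
  fun k => oapp u d (insub k).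

(* Index arrays: 0 holds n and t, 1 the block sizes. Real arrays: 0 holds a,
   1 holds x, 2 holds w. All other cells are 0. *)
Definition input_state : state R := State
  (fun y => match y with
            | 0 => nth 0%N [:: n; t]
            | 1 => cells 0%N sz
            | _ => fun=> 0%N
            end)
  (fun y => match y with
            | 0 => cells 0 (a 0)
            | 1 => cells 0 (x 0)
            | 2 => nth 0 [:: w]
            | _ => fun=> 0
            end).

(* The verdict is cell 0 of index array 2. When it is nonzero, index array 3
   holds delta and real array 3 holds the coefficients of the inequality, the
   coefficient of x_i being in cell i. *)
Definition separation_output (s : state R) : Prop :=
  if imem s 2 0 != 0%N then
    exists delta : 'S_n,
      [/\ forall j : 'I_n, imem s 3 j = delta j,
          forall i : 'I_n, rmem s 3 i = lift_coef sz f a delta i,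
          forall wx, conv_hull (X0 sz f a) wx ->
            lepi_rhs sz f a delta wx.2 <= wx.1
        & w < lepi_rhs sz f a delta x]
  else
    (forall delta : 'S_n, lepi_rhs sz f a delta x <= w) /\
    conv_hull (X0 sz f a) (w, x).

End InputOutput.

(* Main.v *)
(* Within each block replace x by its suffix sums y and a by its increments b, so
   that a(S) = b(D) where D is the downward closure of S in its blocks. The set
   function D |-> f(b(D)) is submodular since b >= 0 and f is concave. Sort the
   indices by decreasing y, with ties broken by index so that every block is
   listed in increasing order, and let pi be the greedy gains of f o b along
   this order. The prefix sums of pi in the blocks are exactly the lifting
   coefficients of the sorting permutation: they are valid by submodularity, and
   they are tight at the set of the largest elements, one per block, of each
   initial segment of the order. These same sets, weighted by the successive
   differences of the sorted y, express (sum_i c_i x_i, x) as a convex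
   combination of points of X_0, so comparing that sum to w decides the
   separation problem. Everything but the sort takes linear time. *)
Require Import Defs.
From mathcomp Require Import all_boot all_order all_fingroup all_algebra.
From mathcomp Require Import all_classical all_reals all_analysis.
From mathcomp Require Import zify ring lra.
Set Implicit Arguments.
Unset Strict Implicit.
Unset Printing Implicit Defensive.
Import Order.TTheory GRing.Theory Num.Theory.
Import numFieldNormedType.Exports.
Local Open Scope ring_scope.
Local Open Scope convex_scope.

(** * Greedy coefficients of a concave function over blocks *)

(** The points [v] and [u + b] lie symmetrically between [u] and [v + b], so the two concavity
    inequalities at the weights [p] and [1 - p] add up to the claim. *)
Lemma concave_diminishing (R : realType) (f : R -> R) (u v b : R) :
  concave f -> u <= v -> 0 <= b -> f (v + b) - f v <= f (u + b) - f u.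
Proof.
move=> cf uv b0; have [d0|dN0] := eqVneq (v + b - u) 0.
  by have -> : v = u by lra.
have d0 : 0 < v + b - u by rewrite lt0r dN0; lra.
set p := b / (v + b - u).
have p0 : 0 <= p by rewrite divr_ge0 // ltW.
have p1 : p <= 1 by rewrite ler_pdivrMr //; lra.
have q0 : 0 <= 1 - p by lra.
have q1 : 1 - p <= 1 by lra.
have pd : p * (v + b - u) = b by rewrite divfK.
have := cf (Itv01 p0 p1) u (v + b); have := cf (Itv01 q0 q1) u (v + b).
rewrite !convRE /= /unstable.onem.
rewrite (_ : p * u + (1 - p) * (v + b) = v); last by lra.
rewrite (_ : (1 - p) * u + (1 - (1 - p)) * (v + b) = u + b); last by lra.
by lra.
Qed.

(** * Increments and prefix sums along the blocks *)

Section BlockOrder.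
Variables (R : realType) (n : nat) (bl : nat -> nat).
Hypothesis bl_homo : {homo bl : i j / (i <= j)%N}.

Definition below (l i : nat) := (l <= i)%N && (bl l == bl i).

Definition starts (i : nat) := (i == 0)%N || (bl i.-1 != bl i).

(** Undoes prefix summation inside a block. It is applied to the weights, to the coefficients and to
    arbitrary linear functionals. *)
Definition incr (G : nat -> R) (i : nat) : R :=
  G i - (if starts i then 0 else G i.-1).

Definition indep (S : {set 'I_n}) :=
  {in S &, forall i j : 'I_n, bl i = bl j -> i = j}.

Definition downset (S : {set 'I_n}) : {set 'I_n} :=
  [set l : 'I_n | [exists i in S, below l i]].

Lemma below_refl i : below i i.
Proof. by rewrite /below leqnn eqxx. Qed.

Lemma below_trans l i j : below l i -> below i j -> below l j.
Proof. by rewrite /below => /andP[? /eqP->] /andP[? ->]; rewrite andbT; lia. Qed.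

(** Monotonicity squeezes [bl i.-1] between [bl l] and [bl i]. *)
Lemma below_starts l i : (l < i)%N -> below l i = ~~ starts i && below l i.-1.
Proof.
case: i => // i; rewrite ltnS /below /starts /= negbK => li.
have := bl_homo li; have := bl_homo (leqnSn i); lia.
Qed.

Lemma sum_incr (G : nat -> R) (i : 'I_n) :
  G i = \sum_(l < n | below l i) incr G l.
Proof.
case: i => i /=; elim: i => [|i IH] i_n.
  rewrite (bigD1 (Ordinal i_n)) ?below_refl //= big1 /incr/= ?subr0 ?addr0 //.
  by move=> l /andP[/andP[l0 _] /eqP/val_eqP/= ?]; exfalso; lia.
rewrite (bigD1 (Ordinal i_n)) ?below_refl //=.
have -> : \sum_(l < n | below l i.+1 && (l != Ordinal i_n)) incr G l =
  if starts i.+1 then 0 else \sum_(l < n | below l i) incr G l.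
  case: ifPn => sti; [apply: big1 => l|apply: eq_bigl => l].
    move=> /andP[lb ni]; have lti : (l < i.+1)%N.
      by move: ni lb; rewrite -val_eqE /below /=; lia.
    by move: lb; rewrite (below_starts lti) sti.
  rewrite -val_eqE /=; have [lti|] := ltnP l i.+1.
    by rewrite (below_starts lti) sti /= andbC; lia.
  by rewrite /below; lia.
by rewrite -IH ?(ltnW i_n) // /incr /=; case: ifP => _; ring.
Qed.

(** After [sum_incr] and an exchange of sums each [l] is counted once: two members of [S] above it
    would share its block. *)
Lemma sum_downset (G : nat -> R) (S : {set 'I_n}) : indep S ->
  \sum_(i in S) G i = \sum_(l in downset S) incr G l.
Proof.
move=> iS; under eq_bigr => i _ do rewrite sum_incr.
rewrite (exchange_big_dep (mem (downset S))) /=; last first.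
  by move=> i l iS' li; rewrite inE; apply/existsP; exists i; rewrite iS'.
apply: eq_bigr => l; rewrite inE => /existsP[i /andP[Si li]].
rewrite (bigD1 i) /= ?Si //= big1 ?addr0 // => j /andP[/andP[Sj lj] /eqP[]].
apply: iS => //; move: li lj; rewrite /below.
by case/andP=> _ /eqP <- /andP[_ /eqP <-].
Qed.

(** * Greedy gains along an order of the indices *)

Section Greedy.
Variables (f : R -> R) (delta : 'S_n).

Definition pos (i : 'I_n) : 'I_n := ((delta^-1)%g : 'S_n) i.

Definition initial (k : nat) : {set 'I_n} := [set l : 'I_n | (pos l < k)%N].

Definition top (k : nat) : {set 'I_n} :=
  [set i in initial k | [forall l in initial k, below i l ==> (l == i)]].

Lemma initialS (k : 'I_n) : initial k.+1 = delta k |: initial k.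
Proof.
apply/setP=> l; rewrite !inE ltnS leq_eqVlt; congr (_ || _).
by rewrite -(inj_eq (@perm_inj _ (delta^-1)%g)) permK.
Qed.

Lemma initial_notin (k : 'I_n) : delta k \notin initial k.
Proof. by rewrite inE /pos permK ltnn. Qed.

Lemma initial0 : initial 0 = finset.set0.
Proof. by apply/setP=> l; rewrite !inE. Qed.

Lemma initialT : initial n = finset.setT.
Proof. by apply/setP=> l; rewrite !inE ltn_ord. Qed.

Lemma sum_initialS (g : 'I_n -> R) (k : 'I_n) :
  \sum_(l in initial k.+1) g l = g (delta k) + \sum_(l in initial k) g l.
Proof. by rewrite initialS big_setU1 ?initial_notin. Qed.

Lemma indep_top k : indep (top k).
Proof.
move=> i j; rewrite !inE => /andP[ik /forall_inP ti] /andP[jk /forall_inP tj] e.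
have [ij|/ltnW ij] := leqP i j.
  by have := ti j; rewrite inE jk /below ij e eqxx => /(_ isT)/eqP.
by have := tj i; rewrite inE ik /below ij e eqxx => /(_ isT)/eqP.
Qed.

(** The order is a linear extension of the block chains, so its initial segments are downward
    closed. *)
Hypothesis delta_chain : forall i l : 'I_n, below i l -> (pos i <= pos l)%N.

Lemma downset_top k : downset (top k) = initial k.
Proof.
apply/setP=> l; rewrite inE; apply/exists_inP/idP => [[i]|lk].
  by rewrite !inE => /andP[ik _] /delta_chain li; exact: leq_ltn_trans li ik.
(* The largest member of the initial segment above [l] is the top of its block. *)
pose P (i : 'I_n) := (i \in initial k) && below l i.
have Pl : P l by rewrite /P lk below_refl.
case: (arg_maxnP (fun i : 'I_n => i : nat) Pl) => i /andP[ik li] imax.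
exists i => //; rewrite inE ik; apply/forall_inP => j jk; apply/implyP => ij.
have /imax ji : P j by rewrite /P jk (below_trans li ij).
by rewrite -val_eqE eqn_leq; apply/andP; split; [exact: ji|case/andP: ij].
Qed.

(** Whatever lies above [delta k] in its block comes no earlier in the order, so inside this segment
    only [delta k] itself remains. *)
Lemma top_last (k : 'I_n) : delta k \in top k.+1.
Proof.
rewrite !inE /pos permK leqnn; apply/forall_inP => l.
rewrite inE => lk; apply/implyP => /delta_chain; rewrite /pos permK => kl.
apply/eqP; rewrite -[l](permKV delta); congr (delta _); apply: val_inj.
by apply/eqP; rewrite /= eqn_leq kl -ltnS lk.
Qed.

Variable A : nat -> R.

Definition acc (k : nat) : R := \sum_(l in initial k) incr A l.

(** The marginal values assigned by Edmonds' greedy algorithm along [delta]. *)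
Definition gain (l : 'I_n) : R := f (acc (pos l).+1) - f (acc (pos l)).

Definition coef (i : nat) : R := \sum_(l < n | below l i) gain l.

Hypothesis f0 : f 0 = 0.

Lemma sum_gain_initial k : (k <= n)%N ->
  \sum_(l in initial k) gain l = f (acc k).
Proof.
elim: k => [|k IH] kn; first by rewrite /acc initial0 !big_set0 f0.
by rewrite (sum_initialS _ (Ordinal kn)) IH ?(ltnW kn) // /gain /pos permK subrK.
Qed.

Lemma coef_gain (i : 'I_n) : incr coef i = gain i.
Proof.
rewrite /incr [X in X - _](bigD1 i) ?below_refl //=.
rewrite -addrA -[RHS]addr0; congr (_ + _).
have lti (l : 'I_n) : below l i && (l != i) -> (l < i)%N.
  by case/andP=> /andP[li _] ni; rewrite ltn_neqAle val_eqE ni.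
case: ifPn => sti.
  rewrite subr0 big1 // => l lb; move: (lti _ lb) => ?.
  by move: lb; rewrite below_starts // sti.
apply/eqP; rewrite subr_eq0; apply/eqP/eq_bigl => l; apply/idP/idP.
  by move=> lb; move: (lti _ lb) => ?; case/andP: lb; rewrite below_starts // sti.
move=> lb; have ltl : (l < i)%N.
  by move: lb sti; rewrite /below /starts; lia.
by rewrite below_starts // sti lb -val_eqE /= neq_ltn ltl.
Qed.

Lemma sum_coef (S : {set 'I_n}) : indep S ->
  \sum_(i in S) coef i = \sum_(l in downset S) gain l.
Proof.
by move=> iS; rewrite (sum_downset coef iS); under eq_bigr do rewrite coef_gain.
Qed.

(** Tightness: the downset of [top k] is the initial segment, over which the gains telescope. *)
Lemma coef_top k : (k <= n)%N ->
  \sum_(i in top k) coef i = f (\sum_(i in top k) A i).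
Proof.
move=> kn; rewrite sum_coef ?(sum_downset A); try exact: indep_top.
by rewrite downset_top sum_gain_initial.
Qed.

Hypothesis cf : concave f.
Hypothesis A_incr : forall i : 'I_n, 0 <= incr A i.

(** Edmonds' argument, by induction along the order: when [delta k] enters, the right side grows by
    at least its gain, because the part of [D] met so far weighs no more than the whole initial
    segment and returns diminish. *)
Lemma gain_le (D : {set 'I_n}) :
  \sum_(l in D) gain l <= f (\sum_(l in D) incr A l).
Proof.
suff H k : (k <= n)%N ->
    \sum_(l in D :&: initial k) gain l <= f (\sum_(l in D :&: initial k) incr A l).
  by have := H n (leqnn n); rewrite initialT finset.setIT.
elim: k => [|k IH] kn; first by rewrite initial0 finset.setI0 !big_set0 f0.
have {IH} := IH (ltnW kn); set j := Ordinal kn.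
rewrite (_ : k = j) // initialS finset.setIUr.
have [jD|jD] := boolP (delta j \in D); last first.
  rewrite (_ : D :&: [set delta j] = finset.set0) ?finset.set0U //.
  by apply/setP=> l; rewrite !inE; case: eqP => [->|]; rewrite ?(negbTE jD) ?andbF.
rewrite (_ : D :&: [set delta j] = [set delta j]); last first.
  by apply/finset.setIidPr; rewrite finset.sub1set.
rewrite !big_setU1; try by rewrite inE negb_and initial_notin orbT.
move=> IH; rewrite {1}/gain /pos permK.
have := @concave_diminishing _ f (\sum_(l in D :&: initial j) incr A l) (acc j)
  (incr A (delta j)) cf.
rewrite /acc sum_initialS ![incr A (delta j) + _]addrC.
move=> /(_ _ (A_incr _))-H.
have : f (\sum_(l in initial j) incr A l + incr A (delta j)) -
       f (\sum_(l in initial j) incr A l) <=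
       f (\sum_(l in D :&: initial j) incr A l + incr A (delta j)) -
       f (\sum_(l in D :&: initial j) incr A l).
  apply: H; rewrite [leRHS](bigID (mem D)) /=.
  rewrite (eq_bigl [pred l | (l \in initial j) && (l \in D)]).
    by rewrite lerDl; apply: sumr_ge0.
  by move=> l; rewrite !inE andbC.
by rewrite /= [incr A (delta j) + _]addrC; lra.
Qed.

Lemma coef_valid (S : {set 'I_n}) : indep S ->
  \sum_(i in S) coef i <= f (\sum_(i in S) A i).
Proof. by move=> iS; rewrite sum_coef // (sum_downset A iS); apply: gain_le. Qed.

End Greedy.
End BlockOrder.

(** * Convex hulls and block indices *)

Section ConvexHull.
Variables (R : realType) (E : lmodType R).

Lemma lmod_convE (u v : convex_lmodType E) (p : {i01 R}) :
  u <| p |> v = p%:num *: (u : E) + (1 - p%:num) *: (v : E) :> E.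
Proof. by []. Qed.

Lemma conv_hull_convex (A : set E) : @convex_set R E (conv_hull A).
Proof.
move=> u v p; rewrite !inE => uA vA B [cB AB].
have := cB u v p; rewrite !inE; apply; [exact: uA|exact: vA].
Qed.

(** Induction on the number of points: split off the last one and rescale the remaining weights by
    their sum [1 - L]. *)
Lemma conv_hull_sum (A : set E) m (c : 'I_m -> R) (p : 'I_m -> E) :
  (forall i, 0 <= c i) -> \sum_i c i = 1 -> (forall i, A (p i)) ->
  conv_hull A (\sum_i c i *: p i).
Proof.
move=> c0 c1 pA; elim: m c p c0 c1 pA => [|m IH] c p c0 c1 pA.
  by move: c1; rewrite big_ord0 => /eqP; rewrite eq_sym oner_eq0.
have pm : conv_hull A (p ord_max) by apply: sub_gen_smallest; exact: pA.
rewrite big_ord_recr /=; move: c1; rewrite big_ord_recr /=.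
set L := c ord_max => c1.
have s0 : 0 <= \sum_(i < m) c (widen_ord (leqnSn m) i) by apply: sumr_ge0.
(* If the last point carries all the weight, rescaling is impossible, but the other weights vanish,
   being nonnegative with sum 0. *)
have [L1|L1] := eqVneq (1 - L) 0.
  rewrite big1 ?add0r => [|i _]; first by rewrite (_ : L = 1) ?scale1r //; lra.
  have /eqP : \sum_(i < m) c (widen_ord (leqnSn m) i) = 0 by lra.
  by rewrite psumr_eq0 // => /allP/(_ i (mem_index_enum i))/eqP->; rewrite scale0r.
have L0 : 0 <= 1 - L by lra.
have L0' : 0 <= L by exact: c0.
have L1' : 1 - L <= 1 by lra.
set q := \sum_(i < m) (c (widen_ord (leqnSn m) i) / (1 - L)) *:
  p (widen_ord (leqnSn m) i).
have qA : conv_hull A q.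
  apply: IH => //; first by move=> i; rewrite divr_ge0.
  by rewrite -mulr_suml (_ : \sum_(i < m) _ = 1 - L) ?divff //; lra.
have := @conv_hull_convex A q (p ord_max) (Itv01 L0 L1'); rewrite !inE.
move=> /(_ qA pm); rewrite lmod_convE /=.
rewrite (_ : 1 - (1 - L) = L); last by lra.
suff -> : (1 - L) *: q =
  \sum_(i < m) c (widen_ord (leqnSn m) i) *: p (widen_ord (leqnSn m) i) by [].
by rewrite scaler_sumr; apply: eq_bigr => i _; rewrite scalerA mulrCA divff ?mulr1.
Qed.

End ConvexHull.

(** * Consecutive blocks as the fibres of a monotone map *)

Section BlockIndex.
Variables (n t : nat) (sz : 'I_t -> nat).

(** Counts the blocks lying entirely before [i]. In this form it is defined and monotone on all of
    [nat], as the results on [bl] require. *)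
Definition block_index (i : nat) : nat :=
  (\sum_(k < t) (block_end sz k.+1 <= i))%N.

Lemma block_index_homo : {homo block_index : i j / (i <= j)%N}.
Proof. by move=> i j ij; apply: leq_sum => k _; case: leqP; case: leqP; lia. Qed.

Lemma block_end0 : block_end sz 0 = 0%N.
Proof. by rewrite /block_end big1. Qed.

Lemma block_endS (k : 'I_t) : block_end sz k.+1 = (block_end sz k + sz k)%N.
Proof.
rewrite /block_end (bigD1 k) //= addnC; congr (_ + _)%N.
by apply: eq_bigl => j; rewrite -val_eqE /=; lia.
Qed.

Lemma block_end_homo : {homo block_end sz : i j / (i <= j)%N}.
Proof.
move=> i j ij; rewrite /block_end [leqRHS](bigID (fun k : 'I_t => (k < i)%N)) /=.
rewrite [X in (_ <= X + _)%N](eq_bigl (fun k : 'I_t => (k < i)%N)) ?leq_addr //.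
by move=> k; apply/andb_idl => ki; exact: leq_trans ki ij.
Qed.

Hypothesis cb : consecutive_blocks n sz.

Lemma block_end_last : block_end sz t = n.
Proof.
case: cb => _ <-; rewrite /block_end; apply: eq_bigl => k; exact: ltn_ord.
Qed.

Lemma block_exists (i : 'I_n) : exists k : 'I_t, i \in block n sz k.
Proof.
have ex : exists m, (i < block_end sz m)%N by exists t; rewrite block_end_last.
(* The least [m] whose block end exceeds [i] is positive since [block_end sz 0] is 0; its
   predecessor is the block sought. *)
case: (ex_minnP ex) => -[|m]; first by rewrite block_end0.
move=> im mmin; have mt : (m < t)%N by apply: mmin; rewrite block_end_last.
exists (Ordinal mt); rewrite inE im andbT leqNgt; apply/negP => /mmin.
by rewrite ltnn.
Qed.

Lemma block_index_eq (k : 'I_t) (i : 'I_n) :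
  i \in block n sz k -> block_index i = k.
Proof.
rewrite inE => /andP[ki ik]; rewrite /block_index.
rewrite (eq_bigr (fun j : 'I_t => nat_of_bool (j < k)%N)) => [|j _].
  rewrite -(big_mkcond (fun j : 'I_t => (j < k)%N) (fun=> 1%N)) /=.
  by rewrite -(big_ord_widen _ (fun=> 1%N) (ltnW (ltn_ord k))) sum_nat_const card_ord muln1.
congr nat_of_bool; have [jk|kj] := ltnP j k.
  exact: leq_trans (block_end_homo jk) ki.
by apply/negbTE; rewrite -ltnNge (leq_trans ik) // block_end_homo.
Qed.

Lemma mem_block (k : 'I_t) (i : 'I_n) :
  (i \in block n sz k) = (block_index i == k).
Proof.
apply/idP/eqP => [/block_index_eq//|ik]; have [l il] := block_exists i.
by have <- : l = k by apply: val_inj; rewrite /= -(block_index_eq il) ik.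
Qed.

Lemma gub_indep (S : {set 'I_n}) :
  reflect (indep block_index S) (gub_set sz S).
Proof.
apply: (iffP forallP) => [gS i j Si Sj ij|iS k].
  have [k ik] := block_exists i; have /card_le1_eqP := gS k.
  by apply; rewrite finset.in_setI ?Si ?Sj //= mem_block -?ij -mem_block.
apply/card_le1_eqP => i j; rewrite !finset.in_setI !mem_block.
by move=> /andP[Si /eqP ik] /andP[Sj /eqP jk]; apply: iS; rewrite ?ik ?jk.
Qed.

End BlockIndex.

(** * Lifted inequalities and the hull of X0 *)

Section LiftedInequalities.
Variables (R : realType) (n t : nat) (sz : 'I_t -> nat).
Variables (f : R -> R) (a : 'rV[R]_n).
Hypotheses (cb : consecutive_blocks n sz) (f0 : f 0 = 0).
Let bl := block_index sz.

Definition indicator (S : {set 'I_n}) : 'rV[R]_n := \row_i (i \in S)%:R.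

Lemma sum_indicator (S : {set 'I_n}) (g : 'I_n -> R) :
  \sum_i g i * indicator S 0 i = \sum_(i in S) g i.
Proof.
rewrite [RHS]big_mkcond; apply: eq_bigr => i _; rewrite mxE.
by case: ifP; rewrite ?mulr1 ?mulr0.
Qed.

Lemma X0_indicator (S : {set 'I_n}) (w : R) :
  gub_set sz S -> f (weight a S) <= w -> X0 sz f a (w, indicator S).
Proof.
move=> gS fw; split=> /=; first by rewrite sum_indicator.
  by move=> i; rewrite mxE; case: (i \in S); [right|left].
move=> k; move/forallP/(_ k): gS; rewrite -(ler_nat R); apply: le_trans.
under eq_bigr do rewrite mxE; rewrite -natr_sum ler_nat big_mkcond /=.
rewrite -sum1_card [leqRHS]big_mkcond /=; apply: leq_sum => i _.
by rewrite finset.in_setI andbC; case: (i \in block n sz k); case: (i \in S).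
Qed.

Lemma X0_indicatorP wx : X0 sz f a wx ->
  exists S : {set 'I_n}, [/\ wx.2 = indicator S, gub_set sz S & f (weight a S) <= wx.1].
Proof.
case: wx => w x [/= fw x01 gx]; pose S := [set i | x 0 i == 1]%SET.
have xS : x = indicator S.
  apply/rowP=> i; rewrite mxE inE; case: eqP => [->//|]; by case: (x01 i).
exists S; split=> //; last by move: fw; rewrite xS sum_indicator.
apply/forallP => k; have := gx k; rewrite xS.
under eq_bigr do rewrite mxE; rewrite -natr_sum (ler_nat R _ 1).
apply: leq_trans; rewrite -sum1_card big_mkcond [leqRHS]big_mkcond /=.
apply: leq_sum => i _.
by rewrite finset.in_setI andbC; case: (i \in block n sz k); case: (i \in S).
Qed.

(** [S] is a candidate in the minimum that defines the coefficient of its last element in the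
    order. *)
Lemma lift_coef_valid (delta : 'S_n) (S : {set 'I_n}) : gub_set sz S ->
  \sum_(i in S) lift_coef sz f a delta i <= f (weight a S).
Proof.
move=> gS; have [->|[i0 Si0]] := set_0Vmem S; first by rewrite /weight !big_set0 f0.
case: (arg_maxnP (fun i : 'I_n => pos delta i : nat) Si0) => i iS imax.
have {iS} Si : i \in S by [].
set j := pos delta i; have ij : i = delta j by rewrite /j /pos permKV.
rewrite (big_setD1 i) //= -lerBrDr {1}ij lift_coefE /lift_min -ij.
have : lift_candidate sz delta j S.
  rewrite /lift_candidate gS -ij Si andbT /= andbT; apply/fintype.subsetP => l Sl.
  apply/imsetP; exists (pos delta l); first by rewrite inE; apply: imax.
  by rewrite /pos permKV.
move=> jS; apply: (le_trans (bigmin_le_cond _ _ jS)).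
by [].
Qed.

Lemma lepi_rhsE (delta : 'S_n) (x : 'rV[R]_n) :
  lepi_rhs sz f a delta x = \sum_i lift_coef sz f a delta i * x 0 i.
Proof. by rewrite [RHS](reindex_inj (@perm_inj _ delta)). Qed.

(** The half-space of the inequality is convex and contains [X0], hence contains the smallest convex
    superset. *)
Lemma lepi_valid (delta : 'S_n) wx : conv_hull (X0 sz f a) wx ->
  lepi_rhs sz f a delta wx.2 <= wx.1.
Proof.
apply: (@smallest_sub _ _ _ [set wx | lepi_rhs sz f a delta wx.2 <= wx.1]%classic).
  move=> u v p; rewrite !inE /= !lepi_rhsE /=.
  have -> : \sum_i lift_coef sz f a delta i *
      (p%:num *: u.2 + (1 - p%:num) *: v.2) 0 i =
      p%:num * (\sum_i lift_coef sz f a delta i * u.2 0 i) +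
      (1 - p%:num) * (\sum_i lift_coef sz f a delta i * v.2 0 i).
    by rewrite !mulr_sumr -big_split; apply: eq_bigr => i _ /=; rewrite !mxE; ring.
  move=> uH vH; apply: lerD; apply: ler_wpM2l => //.
move=> {}wx /X0_indicatorP[S [xS gS fS]] /=; rewrite lepi_rhsE xS sum_indicator.
exact: le_trans (lift_coef_valid delta gS) fS.
Qed.

Section Greedy.
Variables (delta : 'S_n) (A : nat -> R).
Hypothesis delta_chain :
  forall i l : 'I_n, below bl i l -> (pos delta i <= pos delta l)%N.
Hypothesis Aa : forall i : 'I_n, A i = a 0 i.

Lemma weightE (S : {set 'I_n}) : weight a S = \sum_(i in S) A i.
Proof. by apply: eq_bigr => i _; rewrite Aa. Qed.

Section Coefficients.
Hypotheses (cf : concave f) (A_incr : forall i : 'I_n, 0 <= incr bl A i).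
Let c := coef bl f delta A.

(** Strong induction on the position [j] in the order: [coef_valid] makes [c (delta j)] a lower
    bound for every candidate, and [coef_top] shows that [top bl delta j.+1] attains it. *)
Lemma lift_coef_greedy (i : 'I_n) : lift_coef sz f a delta i = c i.
Proof.
rewrite -(permKV delta i); set j := ((delta^-1)%g : 'S_n) i.
have [m] := ubnP (j : nat); elim: m j => // m IH j jm.
have IHS S : lift_candidate sz delta j S ->
    \sum_(l in S :\ delta j) lift_coef sz f a delta l = \sum_(l in S :\ delta j) c l.
  case/and3P=> /fintype.subsetP Sj _ _; apply: eq_bigr => l; rewrite !inE => /andP[lj Sl].
  have /imsetP[k] := Sj l Sl; rewrite inE => kj lk; rewrite lk IH //.
  have : (k != j) by apply: contraNneq lj => <-; rewrite lk.
  rewrite -val_eqE /=; lia.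
have valid S : gub_set sz S -> delta j \in S ->
    c (delta j) <= f (weight a S) - \sum_(l in S :\ delta j) c l.
  move=> /(gub_indep cb) iS Sj; rewrite lerBrDr.
  rewrite -(big_setD1 (delta j) (F := c)) //= weightE.
  exact: (coef_valid (@block_index_homo _ _)).
rewrite lift_coefE /lift_min; apply/le_anti/andP; split.
  have gT : gub_set sz (top bl delta j.+1).
    by apply/(gub_indep cb); exact: indep_top.
  have Tj : lift_candidate sz delta j (top bl delta j.+1).
    rewrite /lift_candidate gT top_last // andbT andbT; apply/fintype.subsetP => l.
    rewrite !inE ltnS => /andP[lj _]; apply/imsetP; exists (pos delta l).
      by rewrite inE.
    by rewrite /pos permKV.
  apply: (le_trans (bigmin_le_cond _ _ Tj)); rewrite (IHS _ Tj) lerBlDr.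
  rewrite -(big_setD1 (delta j) (F := c)) ?top_last //= weightE.
  by rewrite (coef_top (@block_index_homo _ _)).
apply: le_bigmin => [|S jS]; last first.
  by rewrite IHS //; case/and3P: jS => _ gS Sj; exact: valid.
(* What remains is the default value of the minimum, the objective value at the singleton of
   [delta j]. *)
have := valid [set delta j]%SET; rewrite finset.setDv big_set0 subr0 /weight big_set1.
apply; last by rewrite inE.
by apply/(gub_indep cb) => u v; rewrite !inE => /eqP-> /eqP->.
Qed.

End Coefficients.

(** * Convex decomposition along the sorted suffix sums *)

Section Decomposition.
Variables (x : 'rV[R]_n) (y : nat -> R).
Hypothesis yE : forall i : 'I_n, y i = \sum_(l < n | below bl i l) x 0 l.

(** The values of [y] in the order [delta]; the default 0 from [n] on makes the last difference
    equal to the last value. *)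
Definition level (k : nat) : R := oapp (fun j : 'I_n => y (delta j)) 0 (insub k).

Lemma sum_level (i : 'I_n) :
  \sum_(k < n | i \in initial delta k.+1) (level k - level k.+1) = y i.
Proof.
rewrite (eq_bigl (fun k : 'I_n => pos delta i <= k)%N) => [|k]; last first.
  by rewrite inE ltnS.
rewrite -(big_mkord (fun k => pos delta i <= k)%N (fun k => level k - level k.+1)).
rewrite -(@big_nat_widenl _ _ _ (pos delta i) 0 n xpredT) //.
rewrite (eq_bigr (fun k => (- level k.+1) - (- level k))); last first.
  by move=> k _; rewrite opprK addrC.
rewrite telescope_sumr; last exact: ltnW.
by rewrite opprK /level insubF ?ltnn // valK /= permKV; lra.
Qed.

(* Testing the combination of the sets top k against every linear functional G,
   rather than coordinatewise, reduces it to sum_level by summation by parts. *)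
Lemma sum_top_level (G : nat -> R) :
  \sum_(k < n) (level k - level k.+1) * (\sum_(i in top bl delta k.+1) G i) =
  \sum_(i < n) G i * x 0 i.
Proof.
have homo := @block_index_homo _ sz.
transitivity (\sum_(l < n) incr bl G l * y l).
  under eq_bigr => k _.
    rewrite (sum_downset homo) ?downset_top //; last exact: indep_top.
    rewrite mulr_sumr; over.
  rewrite (exchange_big_dep xpredT) //=; apply: eq_bigr => l _.
  by rewrite -sum_level mulr_sumr; apply: eq_bigr => k _; rewrite mulrC.
under eq_bigr => l _ do rewrite yE mulr_sumr.
rewrite (exchange_big_dep xpredT) //=; apply: eq_bigr => i _.
by rewrite -mulr_suml -(sum_incr homo).
Qed.

Hypothesis level_decr : forall k, (k < n)%N -> level k.+1 <= level k.
Hypothesis level_le1 : level 0 <= 1.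

(* Raising every point (f(a(top k)), top k) by the slack w - v keeps it in X0 and
   moves the combination from v up to w. *)
Lemma conv_hull_greedy (w : R) :
  \sum_(i < n) coef bl f delta A i * x 0 i <= w -> conv_hull (X0 sz f a) (w, x).
Proof.
set c := coef bl f delta A; set v := \sum_(i < n) _ => vw.
(* The convex weights are the drops of the sequence 1, [level 0], ..., [level n]; the first one goes
   to the empty set [top 0]. *)
pose lam (k : nat) : R := (if k is 0%N then 1 else level k.-1) - level k.
pose P (k : 'I_n.+1) : R^o * 'rV[R]_n :=
  (f (weight a (top bl delta k)) + (w - v), indicator (top bl delta k)).
have lam_sum : \sum_(k < n.+1) lam k = 1.
  rewrite -(big_mkord xpredT lam) /lam.
  rewrite (eq_bigr (fun k => - level k - (- (if k is 0%N then 1 else level k.-1)))).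
    rewrite (telescope_sumr_eq (fun k => - (if k is 0%N then 1 else level k.-1))) //=.
    by rewrite /level insubF ?ltnn //=; lra.
  by move=> k _; rewrite opprK addrC.
have topG (G : nat -> R) :
    \sum_(k < n.+1) lam k * (\sum_(i in top bl delta k) G i) = \sum_(i < n) G i * x 0 i.
  rewrite big_ord_recl [top _ _ _](_ : _ = finset.set0) ?big_set0 ?mulr0 ?add0r.
    by rewrite -sum_top_level.
  by apply/setP => i; rewrite !inE.
have -> : (w, x) = \sum_(k < n.+1) lam k *: P k.
  rewrite [RHS]surjective_pairing; congr pair.
    rewrite raddf_sum /=.
    (* Tightness replaces each [f (weight a (top k))] by the linear form [c] summed over [top k], to
       which [topG] applies. *)
    rewrite (eq_bigr (fun k : 'I_n.+1 =>
      lam k * (\sum_(i in top bl delta k) c i) + lam k * (w - v))).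
      by rewrite big_split /= topG -mulr_suml lam_sum /v; lra.
    move=> k _; rewrite [LHS]mulrDr weightE.
    by rewrite (coef_top (@block_index_homo _ _) _ _ _ (leq_ord k)).
  apply/rowP => i; rewrite raddf_sum summxE /=.
  (* Coordinate [i] is recovered by testing against the functional that is 1 at [i] and 0
     elsewhere. *)
  have -> : x 0 i = \sum_(j < n) (j == i :> nat)%:R * x 0 j.
    rewrite (bigD1 i) //= eqxx mul1r big1 ?addr0 // => l li.
    by rewrite val_eqE (negbTE li) mul0r.
  rewrite -(topG (fun j => (j == i)%:R)); apply: eq_bigr => k _.
  rewrite !mxE; congr (_ * _); have [iT|iT] := boolP (i \in _).
    rewrite (big_setD1 i) //= eqxx big1 ?addr0 // => l.
    by rewrite !inE val_eqE => /andP[/negbTE->].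
  rewrite big1 // => l lT; case: eqP => // /val_inj li.
  by rewrite -li lT in iT.
apply: conv_hull_sum => //.
  case=> -[|k] kn; rewrite /lam subr_ge0 //=; exact: level_decr.
move=> k; apply: X0_indicator; last by rewrite lerDl subr_ge0.
by apply/(gub_indep cb); exact: indep_top.
Qed.

End Decomposition.
End Greedy.
End LiftedInequalities.

(** * Cost-bounded Hoare logic for the RAM language *)

Section ProgramLogic.
Variables (R : realType) (f : R -> R).

Fixpoint imods (P : cmd) : seq nat :=
  match P with
  | ISet x _ _ => [:: x]
  | Seq P Q | If _ P Q => imods P ++ imods Q
  | While _ P => imods P
  | _ => [::]
  end.

Fixpoint rmods (P : cmd) : seq nat :=
  match P with
  | RSet x _ _ => [:: x]
  | Seq P Q | If _ P Q => rmods P ++ rmods Q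
  | While _ P => rmods P
  | _ => [::]
  end.

(** Modification is tracked per array, so an array that is never assigned keeps all its cells. *)
Definition frame (P : cmd) (s s' : state R) : Prop :=
  (forall y, y \notin imods P -> imem s' y =1 imem s y) /\
  (forall y, y \notin rmods P -> rmem s' y =1 rmem s y).

Lemma frame_trans P s1 s2 s3 : frame P s1 s2 -> frame P s2 s3 -> frame P s1 s3.
Proof.
by move=> [i1 r1] [i2 r2]; split=> y ym j; rewrite ?i2 ?r2 ?i1 ?r1.
Qed.

Lemma exec_frame P s c s' : exec f P s c s' -> frame P s s'.
Proof.
elim=> {P s c s'} [s|s x i e|s x i e|P Q s s1 s2 c1 c2 _ [i1 r1] _ [i2 r2]
  |b P Q s s1 c _|//|b P s s1 s2 c1 c2 _ _ f1 _ f2].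
- by [].
- by split=> //= y; rewrite inE /upd => /negbTE->.
- by split=> //= y; rewrite inE /upd => /negbTE->.
- split=> y /=; rewrite mem_cat negb_or => /andP[yP yQ] j.
    by rewrite i2 ?i1.
  by rewrite r2 ?r1.
- case: (beval f s b) => -[i1 r1]; split=> y /=;
    rewrite mem_cat negb_or => /andP[yP yQ] j; by rewrite ?i1 ?r1.
- exact: frame_trans f1 f2.
Qed.

Definition runs (P : cmd) (s : state R) (N : nat) (Q : state R -> Prop) : Prop :=
  exists c s', [/\ exec f P s c s', (c <= N)%N & Q s'].

(** The frame comes from the execution itself, so postconditions need not mention unchanged
    arrays. *)
Lemma runs_conseq P s N N' (Q Q' : state R -> Prop) :
  runs P s N Q -> (N <= N')%N -> (forall s', frame P s s' -> Q s' -> Q' s') ->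
  runs P s N' Q'.
Proof.
move=> [c [s' [e cN q]]] NN' QQ'; exists c, s'; split=> //.
  exact: leq_trans cN NN'.
exact: QQ' (exec_frame e) q.
Qed.

Lemma runs_seq P1 P2 s N1 N2 (Q Q' : state R -> Prop) :
  runs P1 s N1 Q -> (forall s', frame P1 s s' -> Q s' -> runs P2 s' N2 Q') ->
  runs (Seq P1 P2) s (N1 + N2) Q'.
Proof.
move=> [c1 [s1 [e1 l1 q1]]] H.
have [c2 [s2 [e2 l2 q2]]] := H s1 (exec_frame e1) q1.
by exists (c1 + c2)%N, s2; split=> //; [exact: exec_seq e1 e2|exact: leq_add].
Qed.

(** The invariant is indexed by the number of completed iterations; each of the [m] iterations pays
    for its test and body, and one failing test is added. *)
Lemma runs_while b P s K m (I : nat -> state R -> Prop) :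
  I 0 s ->
  (forall k s', (k < m)%N -> frame P s s' -> I k s' ->
     beval f s' b /\ runs P s' K (I k.+1)) ->
  (forall s', frame P s s' -> I m s' -> ~~ beval f s' b) ->
  runs (While b P) s (m * (bcost b + K).+1 + (bcost b).+1) (I m).
Proof.
move=> I0 step stop.
suff H d k s' : (k + d = m)%N -> frame P s s' -> I k s' ->
    runs (While b P) s' (d * (bcost b + K).+1 + (bcost b).+1) (I m).
  by apply: (H m 0%N).
elim: d k s' => [|d IH] k s' kd fr Ik.
  exists (bcost b).+1, s'; rewrite addn0 in kd; subst k.
  by split=> //; apply: exec_while_stop; apply: stop.
have [bs [c1 [s1 [e1 l1 q1]]]] := step k s' ltac:(lia) fr Ik.
have [||c2 [s2 [e2 l2 q2]]] := IH k.+1 s1 _ _ q1; first by lia.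
  by apply: frame_trans fr _; exact: exec_frame e1.
exists (bcost b + c1 + c2).+1, s2; split=> //; last by lia.
exact: exec_while_step e1 e2.
Qed.

(* On loop-free programs exec is a function, and the cost is bounded by
   charging both branches of each test. *)
Fixpoint loop_free (P : cmd) : bool :=
  match P with
  | Seq P Q | If _ P Q => loop_free P && loop_free Q
  | While _ _ => false
  | _ => true
  end.

Fixpoint cost (P : cmd) : nat :=
  match P with
  | Skip => 1
  | ISet _ i e => (icost i + icost e).+1
  | RSet _ i e => (icost i + rcost e).+1
  | Seq P Q => cost P + cost Q
  | If b P Q => (bcost b + (cost P + cost Q)).+1
  | While _ _ => 0
  end.

Fixpoint result (P : cmd) (s : state R) : state R :=
  match P with
  | Skip | While _ _ => s
  | ISet x i e => State (upd (imem s) x (ieval s i) (ieval s e)) (rmem s)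
  | RSet x i e => State (imem s) (upd (rmem s) x (ieval s i) (reval f s e))
  | Seq P Q => result Q (result P s)
  | If b P Q => if beval f s b then result P s else result Q s
  end.

(** Symbolic execution: a loop-free program is verified by simplifying [result]. *)
Lemma runs_result P s N (Q : state R -> Prop) :
  loop_free P -> (cost P <= N)%N ->
  (frame P s (result P s) -> Q (result P s)) -> runs P s N Q.
Proof.
move=> lP PN; suff [c [e l]] : exists c, exec f P s c (result P s) /\ (c <= cost P)%N.
  move=> H; exists c, (result P s); split=> //; first exact: leq_trans l PN.
  by apply: H; exact: exec_frame e.
elim: P s {PN} lP => //= [s|x i e s|x i e s|P IHP Q' IHQ s /andP[lP lQ]
  |b P IHP Q' IHQ s /andP[lP lQ]].
- by exists 1%N; split=> //; constructor.
- by eexists; split; [constructor|].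
- by eexists; split; [constructor|].
- have [c1 [e1 l1]] := IHP s lP; have [c2 [e2 l2]] := IHQ (result P s) lQ.
  by exists (c1 + c2)%N; split; [exact: exec_seq e1 e2|exact: leq_add].
have [c1 [e1 l1]] := IHP s lP; have [c2 [e2 l2]] := IHQ s lQ.
case bs: (beval f s b).
  by exists (bcost b + c1).+1; split; [apply: exec_if; rewrite bs|lia].
by exists (bcost b + c2).+1; split; [apply: exec_if; rewrite bs|lia].
Qed.

End ProgramLogic.

Local Notation "'var' x" := (IGet x (IConst 0)) (at level 10, x at level 9).
Local Notation "'rvar' x" := (RGet x (IConst 0)) (at level 10, x at level 9).
Definition setvar x e := ISet x (IConst 0) e.
Definition setrvar x e := RSet x (IConst 0) e.
Definition BILt e1 e2 := BILe (IAdd e1 (IConst 1)) e2.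

Definition for_loop (x : nat) (bound : iexp) (body : cmd) : cmd :=
  Seq (setvar x (IConst 0))
      (While (BILt (var x) bound)
         (Seq body (setvar x (IAdd (var x) (IConst 1))))).

(** The invariant must hold after the counter update, so the body has to establish it in every state
    [s2] that differs from its own final state only in array [x]. The constants 14 generously cover
    the test, the update and the initial assignment. *)
Lemma runs_for (R : realType) (f : R -> R) x bound body s K m
    (I : nat -> state R -> Prop) :
  x \notin imods body ->
  (forall s', frame (for_loop x bound body) s s' -> ieval s' bound = m) ->
  (forall s', frame (setvar x (IConst 0)) s s' -> I 0 s') ->
  (forall k s', (k < m)%N -> frame (for_loop x bound body) s s' -> imem s' x 0 = k ->
     I k s' -> runs f body s' K (fun s1 => forall s2,
       (forall y, y != x -> imem s2 y =1 imem s1 y) -> rmem s2 = rmem s1 ->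
       imem s2 x 0 = k.+1 -> I k.+1 s2)) ->
  runs f (for_loop x bound body) s
    (m * (K + icost bound + 14) + icost bound + 14) (I m).
Proof.
move=> xm bd I0 step.
pose J k (s' : state R) := imem s' x 0 = k /\ I k s'.
have -> : (m * (K + icost bound + 14) + icost bound + 14 =
  3 + (m * (K + icost bound + 14) + icost bound + 11))%N by lia.
apply: (@runs_seq _ _ _ _ _ 3 _ (J 0)).
  apply: runs_result => // fr; split; last exact: I0.
  by rewrite /= /upd !eqxx.
move=> s1 fr1 J0.
have frW s' : frame (Seq body (setvar x (IAdd (var x) (IConst 1)))) s1 s' ->
    frame (for_loop x bound body) s s'.
  case: fr1 => i1 r1 [i2 r2]; split=> y; rewrite /for_loop /=.
    by rewrite inE negb_or => /andP[yx ym] j; rewrite i2 ?i1 // inE.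
  by move=> ym j; rewrite r2 ?r1.
apply: (@runs_conseq _ _ _ _ _ _ (J m)); last 2 first.
- exact: leqnn.
- by move=> s' _ [].
(* The 6 is the cost of incrementing the counter. *)
have := @runs_while _ f (BILt (var x) bound)
  (Seq body (setvar x (IAdd (var x) (IConst 1)))) s1 (K + 6) m J J0.
move=> H; apply: (@runs_conseq _ _ _ _ _ _ (J m)).
- apply: H => [k s' km fr [xk Ik]|s' fr [xm' _]]; last first.
    by rewrite /= xm' (bd _ (frW _ fr)) addn1 ltnn.
  split; first by rewrite /= xk (bd _ (frW _ fr)) addn1.
  apply: runs_seq (step k s' km (frW _ fr) xk Ik) _ => s2 [fi _] H2.
  apply: runs_result => // fr3; rewrite /J /= /upd !eqxx /=.
  have x2 : imem s2 x 0 = k by rewrite fi.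
  rewrite x2 addn1; split=> //; apply: H2 => //=.
    by move=> y /negbTE yx j; rewrite /upd yx.
  by rewrite !eqxx.
- by rewrite /=; lia.
by [].
Qed.

(** * Merge sort *)

Section Merging.
Local Open Scope nat_scope.
Variables (leT : rel nat) (n : nat).
Hypotheses (leT_total : total leT) (leT_trans : transitive leT).

Definition sorted_runs (w k : nat) (A : nat -> nat) : Prop :=
  forall m p q, m * w <= p -> p < q -> q < m.+1 * w -> q < k -> leT (A p) (A q).

Section Pass.
Variables (A : nat -> nat) (w : nat).
Hypothesis w_gt0 : 0 < w.

(* Merging the runs [lo, mid) and [mid, hi) of A into B: i and j are the next
   cells of A to be read, k the next cell of B to be written. *)
Definition merging (B : nat -> nat) (r i j k : nat) : Prop :=
  let lo := r * (w + w) in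
  let mid := minn (lo + w) n in
  let hi := minn (lo + w + w) n in
  [/\ lo <= i <= mid, mid <= j <= hi, k = i + (j - mid),
      perm_eq (map B (iota 0 k)) (map A (iota 0 i ++ iota mid (j - mid)))
    & sorted_runs (w + w) k B /\
      forall p, lo <= p < k ->
        (i < mid -> leT (B p) (A i)) /\ (j < hi -> leT (B p) (A j))].

Lemma iota_split m k : m <= k -> iota 0 m ++ iota m (k - m) = iota 0 k.
Proof. by move=> mk; rewrite -{2}[m]add0n -iotaD subnKC. Qed.

Lemma merging_init B : merging B 0 0 (minn w n) 0.
Proof.
rewrite /merging mul0n add0n subnn; split=> //; first by rewrite leqnn; lia.
Qed.

(** Since [k < n], the finished pair of runs is not truncated by [n], so the next pair starts
    exactly at [k]. *)
Lemma merging_next B r i j k :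
  merging B r i j k -> k = minn (r * (w + w) + w + w) n -> k < n ->
  merging B r.+1 k (minn (k + w) n) k.
Proof.
move=> [lim mjh kE pB [sB _]] kh kn.
have imid : i = minn (r * (w + w) + w) n by lia.
have jk : j = k by lia.
rewrite /merging; have -> : r.+1 * (w + w) = k by rewrite mulSn; lia.
rewrite subnn; split; try lia.
  by move: pB; rewrite imid jk iota_split ?cats0 //; lia.
by split=> // p; rewrite ltnNge andbN.
Qed.

Lemma merging_end B r i j : merging B r i j n -> n <= r * (w + w) + w + w ->
  perm_eq (map B (iota 0 n)) (map A (iota 0 n)) /\ sorted_runs (w + w) n B.
Proof.
move=> [lim mjh kE pB [sB _]] nh; split=> //.
have imid : i = minn (r * (w + w) + w) n by lia.
have jn : j = n by lia.
by move: pB; rewrite imid jn iota_split //; lia.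
Qed.

Hypothesis sorted_A : sorted_runs w n A.

(** Every cell written for this pair is below both heads, so appending the smaller head keeps the
    output sorted, and sortedness of the run it came from keeps the cells below the new head. The
    test is an implication written with negation and conjunction, as in the program. *)
Lemma merging_step B B' r i j k :
  let mid := minn (r * (w + w) + w) n in
  let hi := minn (r * (w + w) + w + w) n in
  merging B r i j k -> k < hi -> (forall q, q < k -> B' q = B q) ->
  if (i < mid) && ~~ ((j < hi) && ~~ leT (A i) (A j))
  then B' k = A i -> merging B' r i.+1 j k.+1
  else B' k = A j -> merging B' r i j.+1 k.+1.
Proof.
move=> mid hi [lim mjh kE pB [sB lB]] khi BB'.
have mapB : map B' (iota 0 k) = map B (iota 0 k).
  by apply/eq_in_map => q; rewrite mem_iota add0n => qk; rewrite BB'.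
(* A pair involving the new cell [k] lies in output run [r], whose earlier cells are below the
   appended value. *)
have sB' v : (forall p, r * (w + w) <= p < k -> leT (B p) v) -> B' k = v ->
    sorted_runs (w + w) k.+1 B'.
  move=> lv Bk m p q mp pq qm; rewrite ltnS leq_eqVlt => /predU1P[qk|qk].
    have mr : m = r.
      have : m < r.+1 by rewrite -(ltn_pmul2r (_ : 0 < w + w)) ?mulSn; lia.
      have : r < m.+1 by rewrite -(ltn_pmul2r (_ : 0 < w + w)); lia.
      by lia.
    by rewrite qk Bk BB' ?lv -?mr -?qk ?mp.
  rewrite !BB' //; last by lia. exact: sB mp pq qm qk.
(* Counted in width [w], the left run has number [r + r] and the right run the next one. *)
have sA1 : i.+1 < mid -> leT (A i) (A i.+1).
  by move=> im; apply: (sorted_A (m := r + r)); rewrite ?mulSn; lia.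
have sA2 : j.+1 < hi -> leT (A j) (A j.+1).
  by move=> jh; apply: (sorted_A (m := (r + r).+1)); rewrite ?mulSn; lia.
have iotaS m : iota 0 m.+1 = rcons (iota 0 m) m by rewrite -cats1 -addn1 iotaD.
have perm v X : B' k = v -> perm_eq X (v :: map A (iota 0 i ++ iota mid (j - mid))) ->
    perm_eq (map B' (iota 0 k.+1)) X.
  move=> Bk; rewrite perm_sym => pX; apply: perm_trans pX.
  by rewrite iotaS map_rcons perm_rcons mapB Bk perm_cons.
case: ifPn => [/andP[im cij] Bk|cij Bk].
  have lij : j < hi -> leT (A i) (A j).
    by move=> jh; move: cij; rewrite jh negbK.
  split; try lia; rewrite -/mid -/hi.
  - apply: (perm _ _ Bk); rewrite iotaS cat_rcons.
    by rewrite perm_sym -map_cons; apply: perm_map;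
      rewrite perm_sym perm_catC /= perm_cons perm_catC.
  - split=> [|p]; first by apply: (sB' _ _ Bk) => p /lB[]; auto.
    rewrite ltnS [p <= k]leq_eqVlt => /andP[lp /predU1P[pk|pk]].
      by rewrite pk Bk; split.
    have [l1 l2] := lB p (introT andP (conj lp pk)); rewrite BB' //.
    by split=> // /sA1; apply: leT_trans; exact: l1.
have jh : j < hi.
  case: (ltnP j hi) => // hj; move: cij; rewrite (ltnNge j) hj /= andbT -leqNgt.
  by rewrite /mid /hi in khi *; lia.
have lji : i < mid -> leT (A j) (A i).
  by move=> im; move: cij; rewrite im jh negbK; case: (orP (leT_total (A i) (A j))) => ->.
split; try lia; rewrite -/mid -/hi.
- apply: (perm _ _ Bk); have -> : j.+1 - mid = (j - mid).+1 by lia.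
  rewrite -addn1 iotaD catA map_cat /= perm_catC /=.
  by have -> : mid + (j - mid) = j by lia.
- split=> [|p]; first by apply: (sB' _ _ Bk) => p /lB[]; auto.
  rewrite ltnS [p <= k]leq_eqVlt => /andP[lp /predU1P[pk|pk]].
    by rewrite pk Bk; split.
  have [l1 l2] := lB p (introT andP (conj lp pk)); rewrite BB' //.
  by split=> // /sA2; apply: leT_trans; exact: l2.
Qed.

End Pass.
End Merging.

(* Natural number arrays; 0-3 are imposed by the input and output conventions. *)
Local Notation size_arr := 0%N (only parsing).
Local Notation block_arr := 1%N (only parsing).
Local Notation verdict := 2%N (only parsing).
Local Notation order_arr := 3%N (only parsing).
Local Notation start_arr := 4%N (only parsing).
Local Notation merge_arr := 5%N (only parsing).
Local Notation counter := 6%N (only parsing).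
Local Notation position := 7%N (only parsing).
Local Notation width := 8%N (only parsing).
Local Notation left_head := 9%N (only parsing).
Local Notation right_head := 10%N (only parsing).
Local Notation left_end := 11%N (only parsing).
Local Notation right_end := 12%N (only parsing).
Local Notation current := 13%N (only parsing).

(* Real arrays; 0-3 are imposed by the input and output conventions. *)
Local Notation a_arr := 0%N (only parsing).
Local Notation x_arr := 1%N (only parsing).
Local Notation w_var := 2%N (only parsing).
Local Notation coef_arr := 3%N (only parsing).
Local Notation suffix_arr := 4%N (only parsing).
Local Notation weight_var := 5%N (only parsing).
Local Notation value_var := 6%N (only parsing).
Local Notation base_var := 7%N (only parsing).
Local Notation below_var := 8%N (only parsing).
Local Notation next_var := 9%N (only parsing).

(* e1 - (e1 - e2) is the minimum because ISub truncates. *)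
Definition imin (e1 e2 : iexp) := ISub e1 (ISub e1 e2).

(** Written so that its evaluation is [greedy_le] on the suffix sums. *)
Definition precedes (e1 e2 : iexp) : bexp :=
  BAnd (BRLe (RGet suffix_arr e2) (RGet suffix_arr e1))
       (BNot (BAnd (BRLe (RGet suffix_arr e1) (RGet suffix_arr e2))
                   (BNot (BILe e1 e2)))).

(** Opens a new pair of runs when the output reaches the end of the current one; clearing
    [right_end] before a pass triggers this at once. *)
Definition start_merge : cmd :=
  If (BILe (var right_end) (var counter))
     (Seq (setvar left_head (var counter))
     (Seq (setvar left_end (imin (IAdd (var counter) (var width)) (var size_arr)))
     (Seq (setvar right_head (var left_end))
          (setvar right_end
             (imin (IAdd (IAdd (var counter) (var width)) (var width))
                   (var size_arr))))))
     Skip.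

Definition merge_step : cmd :=
  If (BAnd (BILt (var left_head) (var left_end))
           (BNot (BAnd (BILt (var right_head) (var right_end))
                       (BNot (precedes (IGet order_arr (var left_head))
                                       (IGet order_arr (var right_head)))))))
     (Seq (ISet merge_arr (var counter) (IGet order_arr (var left_head)))
          (setvar left_head (IAdd (var left_head) (IConst 1))))
     (Seq (ISet merge_arr (var counter) (IGet order_arr (var right_head)))
          (setvar right_head (IAdd (var right_head) (IConst 1)))).

Definition merge_pass : cmd :=
  Seq (setvar right_end (IConst 0))
 (Seq (for_loop counter (var size_arr) (Seq start_merge merge_step))
      (for_loop counter (var size_arr)
         (ISet order_arr (var counter) (IGet merge_arr (var counter))))).

Definition merge_sort : cmd :=
  Seq (setvar width (IConst 1))
      (While (BILt (var width) (var size_arr))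
         (Seq merge_pass (setvar width (IAdd (var width) (var width))))).

Section MergeSort.
Variables (R : realType) (f : R -> R) (y : nat -> R).

(* Ties are broken by index, so that sorting keeps each block in its order. *)
Definition greedy_le (i j : nat) : bool :=
  (y j <= y i) && ~~ ((y i <= y j) && ~~ (i <= j)%N).

Lemma greedy_le_total : total greedy_le.
Proof.
move=> i j; rewrite /greedy_le; case: (ltgtP (y i) (y j)) => //= _.
by rewrite !negbK leq_total.
Qed.

Lemma greedy_le_trans : transitive greedy_le.
Proof.
move=> j i k /andP[ji nij] /andP[kj njk]; rewrite /greedy_le (le_trans kj ji) /=.
apply/negP => /andP[ik /negP]; apply.
move: nij njk; rewrite (le_trans ik kj) (le_trans ji ik) /= !negbK.
exact: leq_trans.
Qed.

Variable n : nat.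

Lemma runs_merge_pass s w :
  imem s size_arr 0 = n -> imem s width 0 = w -> (0 < w)%N ->
  rmem s suffix_arr =1 y -> sorted_runs greedy_le w n (imem s order_arr) ->
  runs f merge_pass s (n * 300 + 100) (fun s' =>
    perm_eq (map (imem s' order_arr) (iota 0 n)) (map (imem s order_arr) (iota 0 n)) /\
    sorted_runs greedy_le (w + w) n (imem s' order_arr)).
Proof.
move=> sn sw w0 sy sA; pose mg B := merging greedy_le n (imem s order_arr) w B.
(* The left disjunct describes the state before the first pair is opened. *)
pose I k (s' : state R) :=
  (k = 0%N /\ imem s' right_end 0 = 0%N) \/
  exists r, [/\ mg (imem s' merge_arr) r (imem s' left_head 0) (imem s' right_head 0) k,
    imem s' left_end 0 = minn (r * (w + w) + w) n
    & imem s' right_end 0 = minn (r * (w + w) + w + w) n].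
have step k s' : (k < n)%N -> imem s' size_arr 0 = n -> imem s' width 0 = w ->
    rmem s' suffix_arr =1 y -> imem s' order_arr =1 imem s order_arr ->
    imem s' counter 0 = k -> I k s' ->
    runs f (Seq start_merge merge_step) s' 160 (fun s1 => forall s2,
      (forall z, z != counter -> imem s2 z =1 imem s1 z) -> rmem s2 = rmem s1 ->
      imem s2 counter 0 = k.+1 -> I k.+1 s2).
  move=> kn s'n s'w s'y s'A s'k Ik.
  apply: (@runs_conseq _ _ _ _ (cost start_merge + cost merge_step)%N
    _ _ _ _ _ (fun _ _ H => H)) => //.
  apply: (@runs_seq _ _ _ _ _ _ _ (fun s1 => exists r,
    [/\ mg (imem s1 merge_arr) r (imem s1 left_head 0) (imem s1 right_head 0) k,
      imem s1 left_end 0 = minn (r * (w + w) + w) n,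
      imem s1 right_end 0 = minn (r * (w + w) + w + w) n
      & (k < minn (r * (w + w) + w + w) n)%N])).
    apply: runs_result => // _; rewrite /start_merge /=.
    case: Ik => [[k0 h0]|[r [mr ml mh]]].
      rewrite h0 leq0n /upd /= s'k s'n s'w k0; exists 0%N; rewrite mul0n add0n.
      have -> z : (z - (z - n))%N = minn z n by lia.
      have -> z : (z - (z - n))%N = minn z n by lia.
      split=> //; [exact: merging_init|lia].
    rewrite mh s'k; have [hk|kh] := leqP; last by exists r.
    rewrite /upd /= s'k s'n s'w; exists r.+1.
    have -> z : (z - (z - n))%N = minn z n by lia.
    have -> z : (z - (z - n))%N = minn z n by lia.
    have kE : k = minn (r * (w + w) + w + w) n by case: mr; lia.
    have rk : (r.+1 * (w + w) = k)%N by rewrite mulSn; lia.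
    rewrite rk; split=> //; last by lia.
    exact: merging_next mr kE kn.
  move=> s1 [fi fr] [r [mr ml mh kh]]; apply: runs_result => // _.
  have s1A : imem s1 order_arr =1 imem s order_arr by move=> q; rewrite fi.
  have s1y : rmem s1 suffix_arr =1 y by move=> q; rewrite fr.
  have s1k : imem s1 counter 0 = k by rewrite fi.
  have := @merging_step _ n greedy_le_total greedy_le_trans _ w w0 sA _ _ _ _ _ _ mr kh.
  rewrite /merge_step /= !addn1 !s1A !s1y ml mh s1k -/(greedy_le _ _).
  set b := (_ && _) => H; case: ifP H => _ H s2 Ei Er _; right; exists r;
    rewrite (Ei left_head) // (Ei right_head) // (Ei left_end) // (Ei right_end) //=.
    rewrite /upd /= ?addn1; split=> //; apply: (H (imem s2 merge_arr)).
      by move=> q qk; rewrite Ei // /upd /= ltn_eqF.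
    by rewrite Ei // /upd /= eqxx ?s1A.
  rewrite /upd /= ?addn1; split=> //; apply: (H (imem s2 merge_arr)).
    by move=> q qk; rewrite Ei // /upd /= ltn_eqF.
  by rewrite Ei // /upd /= eqxx ?s1A.
(* 160 bounds a merge step and 6 is the cost of a copy; 2 is the cost of the loop bound and 14 the
   overhead in [runs_for]. *)
apply: (@runs_conseq _ _ _ _ (3 + ((n * (160 + 2 + 14) + 2 + 14) +
  (n * (6 + 2 + 14) + 2 + 14)))%N _ _ _ _ _ (fun _ _ H => H)); last by lia.
apply: (@runs_seq _ _ _ _ _ _ _ (fun s1 => imem s1 right_end 0 = 0%N)).
  by apply: runs_result.
move=> s1 [i1 r1] h1.
apply: runs_seq.
  apply: (@runs_for _ _ counter (var size_arr) _ _ 160 n I) => //.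
  - by move=> s' [i2 _]; rewrite /= i2 // i1.
  - by move=> s' [i2 _]; left; rewrite i2.
  - move=> k s' kn [i2 r2]; apply: step => //.
    + by rewrite i2 // i1.
    + by rewrite i2 // i1.
    + by move=> q; rewrite r2 // r1.
    + by move=> q; rewrite i2 // i1.
move=> s2 [i2 r2] In.
have s2n : imem s2 size_arr 0 = n by rewrite i2 // i1.
have [pB sB] : perm_eq (map (imem s2 merge_arr) (iota 0 n))
                       (map (imem s order_arr) (iota 0 n)) /\
    sorted_runs greedy_le (w + w) n (imem s2 merge_arr).
  case: In => [[n0 _]|[r [mr _ _]]].
    by rewrite n0; split=> // m p q; rewrite ltn0.
  have [lim mjh kE _ _] := mr; have nh : (n <= r * (w + w) + w + w)%N by lia.
  exact: (merging_end w0 mr nh).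
apply: (@runs_conseq _ _ _ _ _ _ (fun s' => forall q, (q < n)%N ->
  imem s' order_arr q = imem s2 merge_arr q)); last 2 first.
- exact: leqnn.
- move=> s3 _ E; split; last first.
    by move=> m p q mp pq qm qn; rewrite !E ?(ltn_trans pq) //; exact: sB mp pq qm qn.
  apply: perm_trans pB; rewrite (_ : map _ _ = map (imem s2 merge_arr) (iota 0 n)) //.
  by apply/eq_in_map => q; rewrite mem_iota add0n => /andP[_ /E].
pose J k (s' : state R) := forall q, (q < k)%N -> imem s' order_arr q = imem s2 merge_arr q.
apply: (@runs_for _ _ counter (var size_arr) _ _ 6 n J) => //.
- by move=> s' [i3 _]; rewrite /= i3.
- move=> k s' kn [i3 _] s'k Jk; apply: runs_result => // _ s4 Ei _ _ q.
  rewrite Ei //= /upd /= s'k i3 // ltnS leq_eqVlt.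
  by case: eqP => [->//|_ /= /Jk].
Qed.

(** Each pass doubles the run length, so after [up_log 2 n] passes a single run covers the array. *)
Lemma runs_merge_sort s : (0 < n)%N ->
  imem s size_arr 0 = n -> rmem s suffix_arr =1 y ->
  runs f merge_sort s (up_log 2 n * (n * 300 + 200) + 100) (fun s' =>
    perm_eq (map (imem s' order_arr) (iota 0 n)) (map (imem s order_arr) (iota 0 n)) /\
    forall p q, (p < q < n)%N -> greedy_le (imem s' order_arr p) (imem s' order_arr q)).
Proof.
move=> n0 sn sy.
pose I k (s' : state R) := [/\ imem s' width 0 = (2 ^ k)%N,
  perm_eq (map (imem s' order_arr) (iota 0 n)) (map (imem s order_arr) (iota 0 n)) &
  sorted_runs greedy_le (2 ^ k) n (imem s' order_arr)].
apply: (@runs_conseq _ _ _ _ 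
  (3 + (up_log 2 n * (7 + (n * 300 + 100 + 7)).+1 + 8))%N _ (I (up_log 2 n))).
- apply: (@runs_seq _ _ _ _ _ _ _ (I 0)).
    apply: runs_result => // _; split=> //= m p q; lia.
  move=> s1 [i1 r1] I0; apply: runs_while => // [k s' km [i2 r2] [wk pk sk]|s' [i2 _] [wk _ _]].
    have s'n : imem s' size_arr 0 = n by rewrite i2 // i1.
    split.
      rewrite /= wk s'n addn1 ltnNge; apply/negP => /(up_log_min (isT : 1 < 2)%N).
      by rewrite leqNgt km.
    apply: (@runs_seq _ _ _ _ _ _ 7).
      apply: (runs_merge_pass s'n wk) => //; first by rewrite expn_gt0.
      by move=> q; rewrite r2 // r1.
    move=> s3 [i3 r3] [p3 s3s]; apply: runs_result => // _.
    have w2 : (2 ^ k + 2 ^ k = 2 ^ k.+1)%N by rewrite expnS mul2n addnn.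
    rewrite /I /= /upd /= i3 // wk w2; split=> //; first exact: perm_trans p3 pk.
    by rewrite -w2.
  by rewrite /= wk i2 // i1 // sn addn1 -leqNgt; exact: up_logP.
- by lia.
- move=> s' _ [_ ps ss]; split=> // p q /andP[pq qn]; apply: (ss 0%N p q) => //.
  by rewrite mul1n; apply: leq_trans qn _; exact: up_logP.
Qed.

End MergeSort.

(** * The separation algorithm *)

Definition mark_starts : cmd :=
  for_loop counter (IGet size_arr (IConst 1))
    (Seq (ISet start_arr (var position) (IConst 1))
         (setvar position
            (IAdd (var position) (IGet block_arr (var counter))))).

(** Runs backwards through the indices and also initialises the order to the identity. The cell [n]
    of [suffix_arr] is never written and acts as a sentinel 0 for the last index. *)
Definition suffix_sums : cmd :=
  for_loop counter (var size_arr)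
    (Seq (setvar current
            (ISub (var size_arr) (IAdd (var counter) (IConst 1))))
    (Seq (ISet order_arr (var counter) (var counter))
         (If (BILe (IGet start_arr (IAdd (var current) (IConst 1))) (IConst 0))
             (RSet suffix_arr (var current)
                (RAdd (RGet x_arr (var current))
                      (RGet suffix_arr (IAdd (var current) (IConst 1)))))
             (RSet suffix_arr (var current) (RGet x_arr (var current)))))).

(** A coefficient is its gain plus the coefficient of its predecessor in the block, so each index
    takes constant time. [weight_var] carries [acc] and [value_var] the partial sum of the
    right-hand side at [x]. *)
Definition greedy : cmd :=
  for_loop counter (var size_arr)
    (Seq (setvar current (IGet order_arr (var counter)))
    (Seq (If (BILe (IGet start_arr (var current)) (IConst 0))
             (Seq (setrvar base_var
                     (RGet a_arr (ISub (var current) (IConst 1))))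
                  (setrvar below_var
                     (RGet coef_arr (ISub (var current) (IConst 1)))))
             (Seq (setrvar base_var RZero) (setrvar below_var RZero)))
    (Seq (setrvar next_var
            (RAdd (rvar weight_var)
                  (RSub (RGet a_arr (var current)) (rvar base_var))))
    (Seq (RSet coef_arr (var current)
            (RAdd (RSub (RCall (rvar next_var)) (RCall (rvar weight_var)))
                  (rvar below_var)))
    (Seq (setrvar value_var
            (RAdd (rvar value_var)
                  (RMul (RGet coef_arr (var current))
                        (RGet x_arr (var current)))))
         (setrvar weight_var (rvar next_var))))))).

Definition decide : cmd :=
  If (BRLe (rvar value_var) (rvar w_var)) Skip (setvar verdict (IConst 1)).

Definition separation : cmd :=
  Seq mark_starts (Seq suffix_sums (Seq merge_sort (Seq greedy decide))).

(** * Correctness and cost of the linear-time phases *)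

Section Starts.
Variables (n t : nat) (sz : 'I_t -> nat).
Hypothesis cb : consecutive_blocks n sz.

Lemma starts_block_end (i : 'I_n) :
  starts (block_index sz) i = [exists k : 'I_t, block_end sz k == i].
Proof.
have [k ik] := block_exists cb i; have bi := block_index_eq ik.
(* A nonempty block contains its starting index, so only the block of [i] can start at [i]. *)
have -> : [exists k : 'I_t, block_end sz k == i] = (block_end sz k == i).
  apply/existsP/idP => [[l /eqP li]|ki]; last by exists k.
  suff -> : k = l by rewrite li.
  apply: val_inj; rewrite /= -bi; apply: block_index_eq.
  by rewrite inE block_endS li leqnn -[X in (X < _)%N]addn0 ltn_add2l (proj1 cb).
move: ik; rewrite inE => /andP[ki ik]; rewrite /starts.
case: i bi ki ik => -[|i] i_n /= bi ki ik; first by apply/esym/eqP; lia.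
have i_n' := ltnW i_n; have := mem_block cb k (Ordinal i_n'); rewrite inE /= => ib.
by rewrite bi -ib; lia.
Qed.

End Starts.

Section Phases.
Variables (R : realType) (f : R -> R) (n t : nat) (sz : 'I_t -> nat).

Lemma runs_mark_starts s :
  imem s size_arr 1 = t -> (forall k : 'I_t, imem s block_arr k = sz k) ->
  imem s position 0 = 0%N -> (forall i, imem s start_arr i = 0%N) ->
  runs f mark_starts s (t * 40 + 40) (fun s' => forall i,
    imem s' start_arr i = [exists k : 'I_t, block_end sz k == i]).
Proof.
move=> st sb sp ss.
pose I k (s' : state R) := imem s' position 0 = block_end sz k /\ forall i,
  imem s' start_arr i = [exists j : 'I_t, (j < k)%N && (block_end sz j == i)].
apply: (@runs_conseq _ _ _ _ (t * (13 + 2 + 14) + 2 + 14)%N _ (I t)); last 2 first.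
- by lia.
- move=> s' _ [_ E] i; rewrite E; congr nat_of_bool; apply: eq_existsb => k.
  by rewrite ltn_ord.
apply: runs_for => //.
- by move=> s' [i1 _]; rewrite /= i1.
- move=> s' [i1 _]; split; first by rewrite i1 // sp block_end0.
  move=> i; rewrite i1 // ss; apply/esym/eqP; rewrite eqb0.
  by apply/existsPn => k; rewrite ltn0.
move=> k s' kt [i1 _] s'k [pk Sk]; apply: runs_result => // _ s2 Ei _ _.
rewrite /I !Ei // /= /upd /= s'k pk i1 // (sb (Ordinal kt)) -(block_endS sz (Ordinal kt)).
split=> // i; rewrite Ei //= /upd /= pk Sk; case: eqP => [->|ik].
  by apply/esym/eqP; rewrite eqb1; apply/existsP; exists (Ordinal kt); rewrite /= ltnSn eqxx.
congr nat_of_bool; apply: eq_existsb => j; rewrite [(j < k.+1)%N]ltnS [(j <= k)%N]leq_eqVlt.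
case: (eqVneq (j : nat) k) => [->|_] //=; rewrite ltnn.
by apply/esym/negbTE/eqP => /esym.
Qed.

Lemma runs_suffix_sums s (Y : nat -> R) :
  imem s size_arr 0 = n -> (forall i, rmem s suffix_arr i = 0) -> Y n = 0 ->
  (forall i, (i < n)%N -> Y i =
     rmem s x_arr i + (if imem s start_arr i.+1 == 0%N then Y i.+1 else 0)) ->
  runs f suffix_sums s (n * 80 + 80) (fun s' => forall i, (i < n)%N ->
    rmem s' suffix_arr i = Y i /\ imem s' order_arr i = i).
Proof.
move=> sn ss Yn YS.
(* The range includes the sentinel cell [n]. *)
pose I k (s' : state R) := (forall i, (n - k <= i <= n)%N -> rmem s' suffix_arr i = Y i) /\
  (forall i, (i < k)%N -> imem s' order_arr i = i).
apply: (@runs_conseq _ _ _ _ (n * (60 + 2 + 14) + 2 + 14)%N _ (I n)); last 2 first.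
- by lia.
- by move=> s' _ [E1 E2] i i_n; rewrite E1 ?E2 //; lia.
apply: runs_for => //.
- by move=> s' [i1 _]; rewrite /= i1.
- move=> s' [_ r1]; split=> // i; rewrite subn0 -eqn_leq => /eqP <-.
  by rewrite r1 // ss Yn.
move=> k s' kn [i1 r1] s'k [Ys Os]; apply: runs_result => // _ s2 Ei Er _.
have s'n : imem s' size_arr 0 = n by rewrite i1.
pose c := (n - k.+1)%N; have cn : (c < n)%N by rewrite /c; lia.
split=> [i ki|i ik].
  have [ic|ic] := eqVneq i c.
    rewrite Er ic /=; case: ifP; rewrite /upd /= !addn1 s'n s'k -/c i1 // leqn0.
      move=> st /=; rewrite eqxx r1 // YS // st Ys //; rewrite /c; lia.
    move=> st /=; rewrite eqxx r1 // YS // st addr0 //.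
  rewrite Er /=; case: ifP; rewrite /upd /= s'n s'k !addn1 -/c (negbTE ic) => _.
    by rewrite Ys //; rewrite /c in ic; lia.
  by rewrite Ys //; rewrite /c in ic; lia.
rewrite Ei //= (fun_if (@imem R)) if_same /= /upd /= s'k.
by move: ik; rewrite ltnS leq_eqVlt; case: eqP => [-> //|_ /= /Os].
Qed.

Variable delta : 'S_n.
Let bl := block_index sz.
Hypothesis delta_chain :
  forall i l : 'I_n, below bl i l -> (pos delta i <= pos delta l)%N.

Lemma runs_greedy s :
  imem s size_arr 0 = n -> (forall k : 'I_n, imem s order_arr k = delta k) ->
  (forall i : 'I_n, imem s start_arr i = starts bl i) ->
  rmem s weight_var 0 = 0 -> rmem s value_var 0 = 0 ->
  let c := coef bl f delta (rmem s a_arr) in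
  runs f greedy s (n * 120 + 120) (fun s' =>
    (forall i : 'I_n, rmem s' coef_arr i = c i) /\
    rmem s' value_var 0 = \sum_(i < n) c i * rmem s x_arr i).
Proof.
move=> sn so ss sw sv c.
pose I k (s' : state R) := [/\
  forall i : 'I_n, i \in initial delta k -> rmem s' coef_arr i = c i,
  rmem s' weight_var 0 = acc bl delta (rmem s a_arr) k &
  rmem s' value_var 0 = \sum_(i in initial delta k) c i * rmem s x_arr i].
apply: (@runs_conseq _ _ _ _ (n * (100 + 2 + 14) + 2 + 14)%N _ (I n)); last 2 first.
- by lia.
- move=> s' _ [E1 _ ->]; rewrite initialT; split=> [i|].
    by apply: E1; rewrite initialT inE.
  by apply: eq_bigl => i; rewrite inE.
apply: runs_for => //.
- by move=> s' [i1 _]; rewrite /= i1.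
- move=> s' [_ r1]; split=> [i| |]; first by rewrite initial0 inE.
    by rewrite r1 // sw /acc initial0 big_set0.
  by rewrite r1 // sv initial0 big_set0.
move=> k s' kn [i1 r1] s'k [Ck Wk Vk].
set j := Ordinal kn; have s'j : imem s' order_arr k = delta j by rewrite i1 // (so j).
have s'a i : rmem s' a_arr i = rmem s a_arr i by rewrite r1.
have s'x i : rmem s' x_arr i = rmem s x_arr i by rewrite r1.
have accS : acc bl delta (rmem s a_arr) k.+1 =
    acc bl delta (rmem s a_arr) k + incr bl (rmem s a_arr) (delta j).
  by rewrite /acc (sum_initialS _ _ j) addrC.
have coefS : c (delta j) =
    f (acc bl delta (rmem s a_arr) k.+1) - f (acc bl delta (rmem s a_arr) k) +
    (if starts bl (delta j) then 0 else rmem s' coef_arr (delta j).-1).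
  have := coef_gain (@block_index_homo _ sz) f delta (rmem s a_arr) (delta j).
  rewrite /gain /pos permK /= => <-; rewrite /incr -/c.
  case: ifPn => [_|nst]; first by rewrite subr0 addr0.
  have lt0 : ((delta j).-1 < n)%N by apply: leq_ltn_trans (leq_pred _) _.
  (* The predecessor comes no later than [delta j] by [delta_chain], and not at the same position
     since the indices differ, so its coefficient is already stored. *)
  rewrite (Ck (Ordinal lt0)) ?subrK // inE.
  have := @delta_chain (Ordinal lt0) (delta j).
  move: nst; rewrite /starts negb_or negbK /below => /andP[j0 /eqP bE] /=.
  rewrite /bl bE eqxx andbT leq_pred /pos permK => /(_ isT); rewrite /= leq_eqVlt.
  case/predU1P => // pk; have pj : (delta^-1)%g (Ordinal lt0) = j by apply: val_inj.
  have /(congr1 val) /= := congr1 delta pj; rewrite permKV /=.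
  by move: j0; lia.
have incrE : incr bl (rmem s a_arr) (delta j) =
    rmem s a_arr (delta j) - (if starts bl (delta j) then 0 else rmem s a_arr (delta j).-1).
  by [].
(* Handles both branches at once: [b0] and [b1] are the values of [base_var] and [below_var]. *)
have step b0 b1 (s2 : state R) :
    b0 = (if starts bl (delta j) then 0 else rmem s a_arr (delta j).-1) ->
    b1 = (if starts bl (delta j) then 0 else rmem s' coef_arr (delta j).-1) ->
    (forall i, rmem s2 coef_arr i = if i == delta j :> nat
       then f (rmem s' weight_var 0 + (rmem s a_arr (delta j) - b0)) -
            f (rmem s' weight_var 0) + b1
       else rmem s' coef_arr i) ->
    rmem s2 weight_var 0 = rmem s' weight_var 0 + (rmem s a_arr (delta j) - b0) ->
    rmem s2 value_var 0 =
      rmem s' value_var 0 + rmem s2 coef_arr (delta j) * rmem s x_arr (delta j) ->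
    I k.+1 s2.
  move=> -> ->; rewrite -incrE Wk -accS -coefS Vk => C2 W2 V2; split=> //.
    move=> i; rewrite (initialS _ j) in_setU1 C2 val_eqE; case: eqP => [->//|_ /= ik].
    exact: Ck.
  by rewrite V2 C2 eqxx (sum_initialS _ _ j) addrC.
apply: runs_result => // _ s2 _ Er _; move: Er.
rewrite /=; case: ifP; rewrite /upd /= s'k s'j i1 // ss leqn0 eqb0 => st Er.
  apply: (step (rmem s a_arr (delta j).-1) (rmem s' coef_arr (delta j).-1)).
  - by rewrite (negbTE st).
  - by rewrite (negbTE st).
  - move=> i; rewrite Er subn1 !s'a; case: eqP => //.
  - by rewrite Er subn1 !s'a.
  - by rewrite Er subn1 !s'a s'x eqxx.
apply: (step 0 0).
- by rewrite (negbFE st).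
- by rewrite (negbFE st).
- by move=> i; rewrite Er s'a; case: eqP.
- by rewrite Er s'a.
- by rewrite Er !s'a s'x eqxx.
Qed.

End Phases.

Lemma perm_iota_perm n (g : nat -> nat) :
  perm_eq (map g (iota 0 n)) (iota 0 n) ->
  exists delta : 'S_n, forall j : 'I_n, g j = delta j.
Proof.
move=> pg; have gn (j : 'I_n) : (g j < n)%N.
  have : g j \in iota 0 n by rewrite -(perm_mem pg) map_f // mem_iota ltn_ord.
  by rewrite mem_iota => /andP[].
have inj : injective (fun j => Ordinal (gn j)).
  have /uniqP u : uniq (map g (iota 0 n)) by rewrite (perm_uniq pg) iota_uniq.
  move=> i j [gij]; apply: val_inj => /=; apply: (u 0%N);
    rewrite ?inE ?size_map ?size_iota //.
  by rewrite !(nth_map 0%N) ?size_iota // !nth_iota.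
by exists (perm inj) => j; rewrite permE.
Qed.

(** Sum of the phase bounds with [t] replaced by [n]: 240 is 40 + 80 + 120, and 400 collects the
    constants, including 60 for the final test. *)
Definition separation_time (n : nat) : nat :=
  (up_log 2 n * (n * 300 + 200) + n * 240 + 400)%N.

(** * Assembling the phases *)

Section Separation.
Variables (R : realType) (f : R -> R) (n t : nat) (sz : 'I_t -> nat).
Variables (a : 'rV[R]_n) (w : R) (x : 'rV[R]_n).
Hypotheses (n_gt0 : (0 < n)%N) (cf : concave f) (f0 : f 0 = 0).
Hypotheses (a_ge0 : forall i, 0 <= a 0 i) (cb : consecutive_blocks n sz).
Hypotheses (ab : ascending_blocks sz a) (x01 : forall i, 0 <= x 0 i <= 1).
Hypothesis (gx : gub_ineqs sz x).
Let bl := block_index sz.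

Definition suffix_sum (i : nat) : R := \sum_(l < n | below bl i l) x 0 l.

Lemma suffix_sumS i : (i < n)%N -> suffix_sum i = cells 0 (x 0) i +
  (if [exists k : 'I_t, block_end sz k == i.+1] then 0 else suffix_sum i.+1).
Proof.
move=> i_n; pose i' := Ordinal i_n.
have -> : cells 0 (x 0) i = x 0 i' by rewrite /cells insubT.
rewrite /suffix_sum (bigD1 i') ?below_refl //=; congr (_ + _).
have homo := @block_index_homo _ sz.
have [iN|Ni] := ltnP i.+1 n; last first.
  rewrite !big1 ?if_same // => l lb; exfalso; move: lb (ltn_ord l).
    by rewrite /below; lia.
  by rewrite -val_eqE /below /=; lia.
rewrite -(starts_block_end cb (Ordinal iN)) /= -/bl.
case: ifPn => st; [apply: big1 => l|apply: eq_bigl => l].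
  move=> /andP[/andP[il /eqP bil]] /=; rewrite -val_eqE /= => li.
  have li' : (i.+1 <= l)%N by rewrite ltn_neqAle eq_sym li il.
  have := homo _ _ li'; have := homo _ _ (leqnSn i); rewrite -/bl.
  by move: st; rewrite /starts /= => /eqP; lia.
move: st; rewrite /starts /= negbK /below => /eqP ->.
by rewrite -val_eqE /=; have [->|] := eqVneq (l : nat) i; rewrite ?andbF ?ltnn //=; lia.
Qed.

Lemma suffix_sum_homo (i l : 'I_n) : below bl i l -> suffix_sum l <= suffix_sum i.
Proof.
move=> il; rewrite /suffix_sum [leRHS](bigID (fun m : 'I_n => below bl l m)) /=.
rewrite [X in _ <= X + _](eq_bigl (fun m : 'I_n => below bl l m)).
  by rewrite lerDl sumr_ge0 // => m _; case/andP: (x01 m).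
by move=> m; apply: andb_idl; exact: below_trans.
Qed.

Lemma suffix_sum_ge0 i : 0 <= suffix_sum i.
Proof. by apply: sumr_ge0 => m _; case/andP: (x01 m). Qed.

Lemma suffix_sum_le1 (i : 'I_n) : suffix_sum i <= 1.
Proof.
have [k ik] := block_exists cb i; apply: le_trans (gx k).
rewrite [leRHS](bigID (fun m : 'I_n => below bl i m)) /=.
rewrite [X in _ <= X + _](eq_bigl (fun m : 'I_n => below bl i m)).
  by rewrite lerDl sumr_ge0 // => m _; case/andP: (x01 m).
move=> m; apply: andb_idl => /andP[_ /eqP]; rewrite (mem_block cb).
by move: ik; rewrite (mem_block cb) /bl => /eqP <- ->.
Qed.

(** An increment is an entry of [a] at a block start and a difference of neighbours in an ascending
    block elsewhere. *)
Lemma incr_weights_ge0 (i : 'I_n) : 0 <= incr bl (cells 0 (a 0)) i.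
Proof.
rewrite /incr {1}/cells valK /=; case: ifPn => st; first by rewrite subr0.
have i1 : (i.-1 < n)%N by apply: leq_ltn_trans (leq_pred _) _.
rewrite /cells insubT /= subr_ge0; have [k ik] := block_exists cb i.
apply: (ab (k := k)) => //=; last exact: leq_pred.
move: ik; rewrite !(mem_block cb) /=; move: st; rewrite /starts.
by rewrite negb_or negbK -/bl => /andP[_ /eqP->].
Qed.

(** Makes the marking phase, linear in [t], linear in [n]. *)
Lemma leq_blocks : (t <= n)%N.
Proof.
case: cb => sz0 <-; rewrite -[leqLHS]card_ord -sum1_card.
by apply: leq_sum => k _; exact: sz0.
Qed.

Lemma runs_separation :
  runs f separation (input_state sz a w x) (separation_time n)
    (separation_output sz f a w x).
Proof.
set s := input_state sz a w x.
apply: (@runs_conseq _ _ _ _ ((t * 40 + 40) + ((n * 80 + 80) +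
  ((up_log 2 n * (n * 300 + 200) + 100) + ((n * 120 + 120) + 60))))%N
  _ _ _ _ _ (fun _ _ H => H)); last first.
  by have := leq_blocks; rewrite /separation_time; lia.
apply: runs_seq.
  apply: (@runs_mark_starts _ _ t sz s) => //.
  by move=> k; rewrite /= /cells valK.
move=> s1 [i1 r1] m1; apply: runs_seq.
  apply: (@runs_suffix_sums _ _ n s1 suffix_sum).
  - by rewrite i1.
  - by move=> i; rewrite r1.
  - rewrite /suffix_sum big1 // => l lb; exfalso; move: lb (ltn_ord l).
    by rewrite /below; lia.
  - by move=> i i_n; rewrite suffix_sumS // r1 // m1 eqb0; case: ifP.
move=> s2 [i2 r2] Y2; apply: runs_seq.
  apply: (@runs_merge_sort _ f (rmem s2 suffix_arr) n s2) => //.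
  by rewrite i2 // i1.
move=> s3 [i3 r3] [p3 le3].
have [delta d3] : exists delta : 'S_n, forall j : 'I_n, imem s3 order_arr j = delta j.
  apply: perm_iota_perm; apply: perm_trans p3 _.
  rewrite (_ : map _ _ = iota 0 n) // -[RHS]map_id; apply/eq_in_map => q.
  by rewrite mem_iota add0n => /andP[_ /Y2[]].
have led (p q : 'I_n) : (p < q)%N ->
    greedy_le suffix_sum (delta p) (delta q).
  move=> pq; have := le3 p q; rewrite pq ltn_ord !d3 => /(_ isT).
  by rewrite /greedy_le !(proj1 (Y2 _ (ltn_ord _))).
(* Suffix sums do not increase along a block, so listing [l] before [i] would require a tie, which
   is broken in favour of the smaller index. *)
have chain (i l : 'I_n) : below bl i l -> (pos delta i <= pos delta l)%N.
  move=> il; rewrite leqNgt; apply/negP => li; have := led _ _ li.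
  rewrite /greedy_le /pos !permKV (suffix_sum_homo il) /= negbK => /andP[_ lei].
  have eil : i = l by apply/val_inj/eqP; rewrite eqn_leq lei andbT; case/andP: il.
  by rewrite eil ltnn in li.
have s3a : rmem s3 a_arr = cells 0 (a 0).
  by apply/funext => i; rewrite r3 // r2 // r1.
have s3x i : rmem s3 x_arr i = cells 0 (x 0) i by rewrite r3 // r2 // r1.
apply: runs_seq.
  apply: (@runs_greedy _ f n t sz delta chain s3).
  - by rewrite i3 // i2 // i1.
  - by move=> k; rewrite d3.
  - by move=> i; rewrite i3 // i2 // m1 (starts_block_end cb).
  - by rewrite r3 // r2 // r1.
  - by rewrite r3 // r2 // r1.
move=> s4 [i4 r4]; rewrite s3a; set c := coef _ _ _ _ => -[C4 V4].
have {}V4 : rmem s4 value_var 0 = \sum_(i < n) c i * x 0 i.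
  by rewrite V4; apply: eq_bigr => i _; rewrite s3x /cells valK.
have Aa (i : 'I_n) : cells 0 (a 0) i = a 0 i by rewrite /cells valK.
have cE (i : 'I_n) : lift_coef sz f a delta i = c i.
  exact: (lift_coef_greedy cb f0 chain Aa cf incr_weights_ge0).
have rhsE : lepi_rhs sz f a delta x = rmem s4 value_var 0.
  by rewrite lepi_rhsE V4; apply: eq_bigr => i _; rewrite cE.
apply: runs_result => // _; rewrite /decide /=.
have s4w : rmem s4 w_var 0 = w by rewrite r4 // r3 // r2 // r1.
rewrite s4w; case: ifPn => [vw|]; last first.
  rewrite -ltNge -rhsE => wv; rewrite /separation_output /upd /=.
  exists delta; split=> //.
  - by move=> j; rewrite i4 // d3.
  - by move=> i; rewrite C4 cE.
  - by move=> wx; exact: lepi_valid.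
have s4v : imem s4 verdict 0 = 0%N by rewrite i4 // i3 // i2 // i1.
rewrite /separation_output s4v /=.
have H : conv_hull (X0 sz f a) (w, x).
  apply: (@conv_hull_greedy _ n t sz f a cb f0 delta (cells 0 (a 0)) chain Aa x suffix_sum).
  - by [].
  (* Below the last position this is the sorting order; at the last one the next level is the
     default 0. *)
  - move=> k kn; rewrite /level; case: insubP => [j _ jk|_] /=.
      rewrite insubT /=; have := led (Ordinal kn) j; rewrite jk ltnSn => /(_ isT).
      by case/andP.
    by rewrite insubT /=; exact: suffix_sum_ge0.
  - by rewrite /level insubT /=; exact: suffix_sum_le1.
  - by rewrite -V4.
(* Membership in the hull yields every lifted inequality at once. *)
by split=> // delta'; exact: (lepi_valid f0 delta' H).
Qed.
End Separation.

(** * The asymptotic bound and the conclusion *)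

Local Open Scope classical_set_scope.

Lemma separation_time_bigO (R : realType) :
  (fun n : nat => (separation_time n)%:R : R^o) =O_\oo
  (fun n : nat => n%:R * ln n%:R : R^o).
Proof.
have l2 : 0 < ln 2 :> R by rewrite ln_gt0 ?ltr1n.
(* 1680 is twice the constant 840 found below; the factor 2 absorbs the rounding in [up_log]. *)
apply/eqO_exP; exists (1680 / ln 2); first by rewrite divr_gt0 ?ltr0n.
exists 2%N => // n /= n2.
have n1 : 1 <= n%:R :> R by rewrite ler1n ltnW.
have l2n : ln 2 <= ln n%:R :> R by rewrite ler_ln ?posrE ?ler_nat // ltr0n; lia.
rewrite !ger0_norm ?mulr_ge0 ?ln_ge0 //.
set u := up_log 2 n.
have u1 : (0 < u)%N by rewrite up_log_gt0.
(* [u] exceeds the binary logarithm by at most one unit, and that unit is paid for by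
   [ln 2 <= ln n%:R]. *)
have ul : u%:R * ln 2 <= 2 * ln n%:R :> R.
  have : u.-1%:R * ln 2 <= ln n%:R :> R.
    rewrite mulrC mulr_natr -lnXn // ler_ln ?posrE ?exprn_gt0 ?ltr0n //; last lia.
    by rewrite -natrX ler_nat ltnW // up_log_gtn.
  by rewrite -[in X in _ -> X](prednK u1) -natr1; lra.
have -> : 1680 / ln 2 * (n%:R * ln n%:R) = 840 * n%:R * (2 * ln n%:R) / ln 2 :> R by lra.
rewrite ler_pdivlMr //.
(* With [n] at least 2 and [u] at least 1, the terms are at most 300, 100, 240 and 200 times
   [n * u]. *)
apply: (@le_trans _ _ ((840 * n * u)%:R * ln 2)).
  by rewrite ler_wpM2r ?(ltW l2) // ler_nat /separation_time -/u; nia.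
by rewrite !natrM -[leLHS]mulrA; apply: ler_wpM2l ul; rewrite mulr_ge0 ?ler0n.
Qed.

(** One program and one time bound are fixed before the instance, so the algorithm is uniform; by
    [exec_det] the run found is the only one. *)
Theorem corollary5p5 (R : realType) :
  exists (P : cmd) (T : nat -> nat),
    (fun n : nat => (T n)%:R : R^o) =O_\oo (fun n : nat => n%:R * ln n%:R : R^o)
    /\
    forall (n t : nat) (sz : 'I_t -> nat) (f : R -> R) (a : 'rV[R]_n)
           (w : R) (x : 'rV[R]_n),
      (0 < n)%N -> (0 < t)%N ->
      concave f -> f 0 = 0 ->
      (forall i, 0 <= a 0 i) ->
      consecutive_blocks n sz ->
      ascending_blocks sz a ->
      (forall i, 0 <= x 0 i <= 1) ->
      gub_ineqs sz x ->
      exists (c : nat) (s : state R),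
        [/\ exec f P (input_state sz a w x) c s,
            (c <= T n)%N
          & separation_output sz f a w x s].
Proof.
exists separation, separation_time; split; first exact: separation_time_bigO.
move=> n t sz f a w x n0 _ cf f0 a0 cb ab x01 gx.
exact: runs_separation.
Qed.
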